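(* Let $n$ be the dimension and let $\rho,\lambda,\Lambda>0$. Let $\Omega\subset\mathbb{R}^n$ be a convex domain and $\phi:\overline\Omega\to\mathbb{R}$ a convex function satisfying the structural conditions (H) with constants $\rho,\lambda,\Lambda$. Let $A\subset\overline\Omega$ and suppose that for each $x\in A$ a section $S_\phi(x,t)$ is given such that $t$ is bounded by a fixed number $M$ (independent of $x$). Denote by $\mathcal F$ the family of all these sections. Then there exists a countable subfamily $\{S_\phi(x_k,t_k)\}_{k=1}^\infty$ of $\mathcal F$ with the following properties: (i) $A\subset\bigcup_{k=1}^\infty S_\phi(x_k,t_k)$; (ii) $x_k\notin\bigcup_{j<k}S_\phi(x_j,t_j)$ for all $k\ge2$; (iii) the family $\{S_\phi(x_k,t_k/\alpha)\}_{k=1}^\infty$ is disjoint, where $\alpha=2\theta_*^2$ and $\theta_*$ is the engulfing constant; (iv) there exists a constant $K>0$ depending only on $\rho,\lambda,\Lambda$ and $n$ such that $$\sum_{k=1}^\infty\chi_{S_\phi(x_k,(1-\varepsilon)t_k)}(x)\le K\log\frac1\varepsilon\quad\text{for all } 0<\varepsilon<1$$ (and all $x$).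
   Context: Structural conditions (H) with constants $\rho,\lambda,\Lambda>0$: (1) $\Omega\subset B_{1/\rho}$ (the ball of radius $1/\rho$ centered at the origin), and for every $x_0\in\partial\Omega$ there is an open ball of radius $\rho$ contained in $\Omega$ and tangent to $\partial\Omega$ at $x_0$; (2) $\phi\in C^{0,1}(\overline\Omega)\cap C^2(\Omega)$ is convex and $\det D^2\phi=g$ in $\Omega$ with $0<\lambda\le g\le\Lambda$; (3) $\rho|x-x_0|^2\le\phi(x)-\phi(x_0)-\nabla\phi(x_0)\cdot(x-x_0)\le\rho^{-1}|x-x_0|^2$ for all $x,x_0\in\partial\Omega$. At boundary points, $\nabla\phi(x_0)$ denotes the value of the continuous extension of $\nabla\phi$ to $\overline\Omega$. The section of $\phi$ centered at $x\in\overline\Omega$ with height $h>0$ is $S_\phi(x,h):=\{y\in\overline\Omega:\ \phi(y)<\phi(x)+\nabla\phi(x)\cdot(y-x)+h\}$. $\chi_E$ is the characteristic function of $E$. The countable subfamily may be finite. The engulfing constant $\theta_*>1$ is a fixed constant depending only on $\rho,\lambda,\Lambda,n$ such that for every $\Omega,\phi$ satisfying (H) with constants $\rho,\lambda,\Lambda$, all $x\in\overline\Omega$, $t>0$ and $y\in S_\phi(x,t)$, one has $S_\phi(x,t)\subset S_\phi(y,\theta_*t)$ (such a constant exists).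
   Formalization: In (iv) the bound K log(1/ε) is replaced by K max(1, log(1/ε)) for all 0<ε<1, since the literal bound fails as ε→1: at a center x_k the sum is at least 1 while K log(1/ε) tends to 0. *)

(* Defs.v *)
From HB Require Import structures.
From mathcomp Require Import all_boot all_order all_algebra.
From mathcomp Require Import all_classical all_reals all_analysis.
Set Implicit Arguments.
Unset Strict Implicit.
Unset Printing Implicit Defensive.
Import Order.TTheory GRing.Theory Num.Theory.
Import numFieldNormedType.Exports.
Local Open Scope classical_set_scope.
Local Open Scope ring_scope.

(* The library norm on 'rV[R]_n is the sup norm; the balls and the quadratic
   bounds below are Euclidean.  The topology is the same for both norms. *)
Definition dot (R : realType) (n : nat) (x y : 'rV[R]_n) : R :=
  \sum_(i < n) x ord0 i * y ord0 i.

Definition enorm (R : realType) (n : nat) (x : 'rV[R]_n) : R :=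
  Num.sqrt (dot x x).

Definition eball (R : realType) (n : nat) (c : 'rV[R]_n) (r : R) :
    set 'rV[R]_n :=
  [set x | enorm (x - c) < r].

Definition bdry (T : topologicalType) (A : set T) : set T :=
  closure A `\` interior A.

Definition partial (R : realType) (n : nat) (i : 'I_n) (f : 'rV[R]_n -> R^o) :
    'rV[R]_n -> R^o :=
  'D_(delta_mx ord0 i : 'rV[R]_n) f.

Definition has_partial (R : realType) (n : nat) (i : 'I_n)
    (f : 'rV[R]_n -> R^o) (x : 'rV[R]_n) : Prop :=
  derivable f x (delta_mx ord0 i : 'rV[R]_n).

Definition grad (R : realType) (n : nat) (f : 'rV[R]_n -> R^o)
    (x : 'rV[R]_n) : 'rV[R]_n :=
  \row_(i < n) partial i f x.

Definition hessian (R : realType) (n : nat) (f : 'rV[R]_n -> R^o)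
    (x : 'rV[R]_n) : 'M[R]_n :=
  \matrix_(i < n, j < n) partial j (partial i f) x.

Definition C2_on (R : realType) (n : nat) (Omega : set 'rV[R]_n)
    (f : 'rV[R]_n -> R^o) : Prop :=
  forall x, Omega x ->
    [/\ {for x, continuous f},
        forall i, has_partial i f x /\ {for x, continuous (partial i f)}
      & forall i j, has_partial j (partial i f) x /\
                    {for x, continuous (partial j (partial i f))}].

(* Continuous extension of the gradient to the closure of Omega: the limit of
   grad f (y) as y tends to x within Omega.  For x in Omega and f of class C2
   this is grad f x.  Existence of the limit is a field of [structural]. *)
Definition egrad (R : realType) (n : nat) (Omega : set 'rV[R]_n)
    (f : 'rV[R]_n -> R^o) (x : 'rV[R]_n) : 'rV[R]_n :=
  lim (grad f @ within Omega (nbhs x)).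

(* Only the values of phi on the closure of Omega matter below: Omega is open,
   so derivatives at its points are determined by phi on Omega. *)
Record structural (R : realType) (n : nat) (rho lambda Lambda : R)
    (Omega : set 'rV[R]_n) (phi : 'rV[R]_n -> R^o) : Prop := Structural {
  dom_nonempty : Omega !=set0 ;
  dom_open : open Omega ;
  dom_convex : convex_set (Omega : set (convex_lmodType 'rV[R]_n)) ;
  dom_bounded : Omega `<=` eball 0 (rho^-1) ;
  (* a ball contained in the open set Omega is tangent to the boundary at x0
     exactly when x0 lies on its sphere *)
  interior_ball : forall x0, bdry Omega x0 ->
    exists2 c, eball c rho `<=` Omega & enorm (x0 - c) = rho ;
  phi_lipschitz : [lipschitz phi x | x in closure Omega] ;
  phi_C2 : C2_on Omega phi ;
  phi_convex :
    convex_function (closure Omega : set (convex_lmodType 'rV[R]_n)) phi ;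
  phi_det : exists g : 'rV[R]_n -> R, forall x, Omega x ->
    \det (hessian phi x) = g x /\ lambda <= g x <= Lambda ;
  grad_extends : forall x, closure Omega x ->
    cvg (grad phi @ within Omega (nbhs x)) ;
  quad_separation : forall x x0, bdry Omega x -> bdry Omega x0 ->
    rho * enorm (x - x0) ^+ 2
      <= phi x - phi x0 - dot (egrad Omega phi x0) (x - x0)
      <= rho^-1 * enorm (x - x0) ^+ 2
}.

(* S_phi(x, h) *)
Definition msection (R : realType) (n : nat) (Omega : set 'rV[R]_n)
    (phi : 'rV[R]_n -> R^o) (x : 'rV[R]_n) (h : R) : set 'rV[R]_n :=
  [set y | closure Omega y /\
           phi y < phi x + dot (egrad Omega phi x) (y - x) + h].

Definition engulfing_constant (R : realType) (n : nat)
    (rho lambda Lambda theta : R) : Prop :=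
  1 < theta /\
  forall (Omega : set 'rV[R]_n) (phi : 'rV[R]_n -> R^o),
    structural rho lambda Lambda Omega phi ->
    forall (x y : 'rV[R]_n) (t : R), closure Omega x -> 0 < t ->
      msection Omega phi x t y ->
      msection Omega phi x t `<=` msection Omega phi y (theta * t).

(* Index sets of finite or infinite sequences: `I_N or setT. *)
Definition initial_segment (D : set nat) : Prop :=
  forall j k : nat, (j <= k)%N -> D k -> D j.

(* Main.v *)
Require Import Defs.
From HB Require Import structures.
From mathcomp Require Import all_boot all_order all_algebra.
From mathcomp Require Import all_classical all_reals all_analysis.
From mathcomp Require Import perm ring lra.
Set Implicit Arguments.
Unset Strict Implicit.
Unset Printing Implicit Defensive.
Import Order.TTheory GRing.Theory Num.Theory.
Import numFieldNormedType.Exports.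
Local Open Scope classical_set_scope.
Local Open Scope ring_scope.

(** The quantity behind all of the argument is the excess
    E(x, y) = phi y - phi x - grad phi (x) . (y - x) of phi over its tangent
    plane at x, so that S_phi(x, h) = {y | E(x, y) < h}.  It is nonnegative
    because phi is convex, and engulfing makes it a quasi-metric: points at
    excess <= t from a common point are at excess <= theta t from each other
    (lemma [engulf]).

    Selection.  Choose x_k greedily among the points not yet covered, with
    t(x_k) at least half of the supremum of the remaining heights.  Then x_k
    avoids the earlier sections and t(x_k) <= 2 t(x_j) for j < k.  If
    S(x_j, t_j / alpha) met S(x_k, t_k / alpha), two applications of engulfing
    would put x_k in S(x_j, t_j); this gives the disjointness.

    Packing.  Sections are convex and star-shaped about their centre, so a
    homothetic copy of a convex body B, centred at x_k and of fixed ratio,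
    fits in S(x_k, t_k / alpha) whenever B lies in a section of x_k of
    comparable height.  These copies are disjoint, and a convex body contains
    only boundedly many points with disjoint homothetic copies ([packing]).
    With B the whole domain, the heights of an infinite selection tend to 0,
    hence the selected sections cover A.  With B a section centred at a point
    z, boundedly many selected sections of comparable height contain z.

    Overlap.  It remains to bound the number of dyadic generations of heights
    among the sections whose shrinking contains z.  If z lies in
    S(x_i, (1 - eps) t_i) and in S(x_j, t_j) with i < j, then x_j is outside
    S(x_i, t_i) although E(z, x_j) <= theta t_j, so the excess E(x_i, .)
    increases by eps t_i between z and x_j.  The estimate [excess_hoelder],
    E(x, y) <= E(x, z) + C d t as soon as E(x, z) <= t and E(z, y) <= d^p t,
    forces t_j >= c eps^p t_i, that is O(1 + log(1 / eps)) generations.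

    The Hoelder estimate.  The increase of E(x, .) from z to y is, up to
    E(z, y), the product of grad phi (z) - grad phi (x) with y - z, and
    [three_point] bounds the product with b - c by E(x, b) + E(z, c).  So it
    suffices to write y - z as d (b - c) with b and c at excess O(t) from z.
    Restricted to a line, engulfing makes the excess doubling
    ([excess_growth]), so the segment [z, y] can be prolonged by a factor 1 / d
    at excess O(t), unless it leaves the domain in both directions.  In that
    case it is part of a chord [Q, P] with endpoints on the boundary, and the
    quadratic separation relates the length L of the chord to its excess.
    If L^2 is at least of order t, the chord itself is long enough.  If not,
    the ball tangent at Q provides a boundary point at distance of order
    sqrt t from Q, in the direction of the chord up to an error O(t)
    ([tangent_chord]), whose excess is O(t) by quadratic separation again; the
    error is harmless because it is directed to the centre of the ball. *)

Ltac rowring := apply/rowP=> ?; rewrite !mxE; ring.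

(** * Open convex sets and their boundary *)

Section ConvexDomain.
Variables (R : realType) (n : nat) (Om : set 'rV[R]_n).

Lemma open_norm_ball : open Om ->
  forall x, Om x -> exists2 e : R, 0 < e & forall y, `|y - x| < e -> Om y.
Proof.
move=> Oop x Ox; have /nbhs_ballP[e /= e0 he] : nbhs x Om by exact: open_nbhs_nbhs.
exists e => // y yx; apply: he; rewrite -ball_normE /ball_ /=.
by rewrite distrC.
Qed.

Lemma closure_norm x (e : R) : closure Om x -> 0 < e ->
  exists2 y, Om y & `|y - x| < e.
Proof.
move=> cx e0; have [y [Ay]] := cx _ (nbhsx_ballx x e e0).
by rewrite -ball_normE /ball_ /= distrC; exists y.
Qed.

Lemma norm_closure x :
  (forall e : R, 0 < e -> exists2 y, Om y & `|y - x| < e) -> closure Om x.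
Proof.
move=> H B /nbhs_ballP[e /= e0 he]; have [y Ay yx] := H e e0.
by exists y; split=> //; apply: he; rewrite -ball_normE /ball_ /= distrC.
Qed.

Hypothesis Oop : open Om.
Hypothesis Ocv : convex_set (Om : set (convex_lmodType 'rV[R]_n)).

Lemma convex_segment a b (s : R) : Om a -> Om b -> 0 <= s <= 1 ->
  Om (a + s *: (b - a)).
Proof.
move=> Oa Ob /andP[s0 s1].
have := @Ocv b a (Itv01 s0 s1).
rewrite !inE => /(_ Ob Oa); rewrite /conv/=.
by congr Om; rewrite /unstable.onem; rowring.
Qed.

Lemma closure_segment a b (s : R) : closure Om a -> closure Om b ->
  0 <= s <= 1 -> closure Om (a + s *: (b - a)).
Proof.
move=> ca cb s01; apply: norm_closure => e e0.
have e20 : 0 < e / 2 by rewrite divr_gt0.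
have [a' Oa' /ltW aa'] := closure_norm ca e20.
have [b' Ob' /ltW bb'] := closure_norm cb e20.
exists (a' + s *: (b' - a')); first exact: convex_segment.
have -> : a' + s *: (b' - a') - (a + s *: (b - a)) =
  (1 - s) *: (a' - a) + s *: (b' - b) by rowring.
have /andP[s0 s1] := s01.
apply: le_lt_trans (ler_normD _ _) _; rewrite !normrZ ger0_norm ?subr_ge0// ger0_norm//.
have s10 : 0 <= 1 - s by rewrite subr_ge0.
have := ler_wpM2l s0 bb'; have := ler_wpM2l s10 aa'; lra.
Qed.

(** Moving b to a nearby point b' of the open set moves a by a multiple of
    b' - b, which keeps it in a ball around a. *)
Lemma interior_segment a b (s : R) : Om a -> closure Om b ->
  0 <= s < 1 -> Om (a + s *: (b - a)).
Proof.
move=> Oa cb /andP[s0 s1].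
have [e e0 he] := open_norm_ball Oop Oa.
have s10 : 0 < 1 - s by rewrite subr_gt0.
have e'0 : 0 < e * (1 - s) by rewrite mulr_gt0.
have [b' Ob' bb'] := closure_norm cb e'0.
pose a' := a - (s / (1 - s)) *: (b' - b).
have -> : a + s *: (b - a) = a' + s *: (b' - a').
  by apply/rowP=> i; rewrite !mxE; field; rewrite gt_eqF.
apply: convex_segment => //; last by rewrite s0 ltW.
apply: he; rewrite /a' addrC addKr normrN normrZ ger0_norm; last first.
  by rewrite divr_ge0// ltW.
rewrite mulrAC ltr_pdivrMr//.
have := normr_ge0 (b' - b); nra.
Qed.

Lemma bdryP x : bdry Om x <-> closure Om x /\ ~ Om x.
Proof. by rewrite /bdry (interior_id _).1. Qed.

(** The last point of the segment that lies in the closure is a boundary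
    point: if it were interior, the segment would stay inside a little longer. *)
Lemma exit_point a b : closure Om a -> ~ Om b ->
  exists2 s : R, 0 <= s <= 1 & bdry Om (a + s *: (b - a)).
Proof.
move=> ca nb.
pose S : set R := [set s | 0 <= s <= 1 /\ closure Om (a + s *: (b - a))].
have S0 : S 0 by split; [rewrite lexx ler01|rewrite scale0r addr0].
have Sub : ubound S 1 by move=> s [/andP[]].
have Shs : has_sup S by split; [exists 0|exists 1].
pose s := sup S.
have s0 : 0 <= s by apply: ub_le_sup; [exists 1|].
have s1 : s <= 1 by apply: ge_sup => //; exists 0.
have cs : closure Om (a + s *: (b - a)).
  apply: norm_closure => e e0.
  have d0 : 0 < e / 2 / (`|b - a| + 1).
    by rewrite !divr_gt0 // ltr_pwDr.
  have [r [r01 cr] rs] := sup_adherent d0 Shs.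
  have rles : r <= s := ub_le_sup (ex_intro _ 1 Sub) (conj r01 cr).
  have e20 : 0 < e / 2 by rewrite divr_gt0.
  have [y Oy yr] := closure_norm cr e20.
  exists y => //.
  have -> : y - (a + s *: (b - a)) =
    (y - (a + r *: (b - a))) + (r - s) *: (b - a) by rowring.
  apply: le_lt_trans (ler_normD _ _) _; rewrite normrZ.
  have -> : `|r - s| = s - r by rewrite distrC ger0_norm ?subr_ge0.
  have : (s - r) * `|b - a| <= e / 2.
    apply: (@le_trans _ _ (e / 2 / (`|b - a| + 1) * (`|b - a| + 1))).
      apply: ler_pM; rewrite ?subr_ge0// ?lerDl//.
      by rewrite lerBlDr addrC -lerBlDr ltW.
    by rewrite divfK// gt_eqF// ltr_pwDr.
  lra.
exists s; first by rewrite s0.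
apply/bdryP; split=> // Os.
have sne1 : s < 1.
  rewrite lt_neqAle s1 andbT; apply/eqP => E; apply: nb; move: Os.
  by rewrite E scale1r addrC subrK.
have [e e0 he] := open_norm_ball Oop Os.
pose d := Num.min (1 - s) (e / 2 / (`|b - a| + 1)).
have p0 : 0 < `|b - a| + 1 by rewrite ltr_pwDr.
have d0 : 0 < d by rewrite lt_min subr_gt0 sne1/= !divr_gt0.
have dl1 : d <= 1 - s by rewrite ge_min lexx.
have dl2 : d * (`|b - a| + 1) <= e / 2 by rewrite -ler_pdivlMr// ge_min lexx orbT.
have : S (s + d).
  split; first by apply/andP; split; lra.
  apply: subset_closure; apply: he.
  have -> : a + (s + d) *: (b - a) - (a + s *: (b - a)) = d *: (b - a) by rowring.
  by rewrite normrZ gtr0_norm//; nra.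
move=> /(ub_le_sup (ex_intro _ 1 Sub)); rewrite -/s; lra.
Qed.

(** Otherwise b would lie strictly between a point of the closure and a point
    of the open set, hence in the open set. *)
Lemma outside_beyond a b (m : R) : closure Om a -> bdry Om b -> 1 < m ->
  ~ Om (a + m *: (b - a)).
Proof.
move=> ca /bdryP[cb nb] m1 Oe; apply: nb.
have m0 : 0 < m by lra.
have := @interior_segment _ a (1 - m^-1) Oe ca.
have -> : a + m *: (b - a) + (1 - m^-1) *: (a - (a + m *: (b - a))) = b.
  by apply/rowP=> i; rewrite !mxE; field; rewrite gt_eqF.
apply; rewrite subr_ge0 invf_le1// ltW//= ltrBlDr ltrDl invr_gt0//.
Qed.
End ConvexDomain.

(** * Euclidean geometry of row vectors *)

Section Dot.
Variables (R : realType) (n : nat).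
Implicit Types x y z : 'rV[R]_n.

Lemma dotC x y : dot x y = dot y x.
Proof. by apply: eq_bigr => i _; rewrite mulrC. Qed.

Lemma dotDr x y z : dot x (y + z) = dot x y + dot x z.
Proof. by rewrite -big_split; apply: eq_bigr => i _; rewrite !mxE mulrDr. Qed.

Lemma dotZr (a : R) x y : dot x (a *: y) = a * dot x y.
Proof. by rewrite /dot mulr_sumr; apply: eq_bigr => i _; rewrite !mxE mulrCA. Qed.

Lemma dotNr x y : dot x (- y) = - dot x y.
Proof. by rewrite -scaleN1r dotZr mulN1r. Qed.

Lemma dotBr x y z : dot x (y - z) = dot x y - dot x z.
Proof. by rewrite dotDr dotNr. Qed.

Lemma dotDl x y z : dot (x + y) z = dot x z + dot y z.
Proof. by rewrite !(dotC _ z) dotDr. Qed.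

Lemma dotZl (a : R) x y : dot (a *: x) y = a * dot x y.
Proof. by rewrite !(dotC _ y) dotZr. Qed.

Lemma dotNl x y : dot (- x) y = - dot x y.
Proof. by rewrite !(dotC _ y) dotNr. Qed.

Definition dotE := (dotDl, dotDr, dotNl, dotNr, dotZl, dotZr).

Lemma dot_comb_sqr (a b : R) x y : dot (a *: x + b *: y) (a *: x + b *: y) =
  a ^+ 2 * dot x x + 2 * a * b * dot x y + b ^+ 2 * dot y y.
Proof. rewrite !dotE (dotC y x); ring. Qed.

Lemma dot_ge0 x : 0 <= dot x x.
Proof. by apply: sumr_ge0 => i _; rewrite -expr2 sqr_ge0. Qed.

Lemma enorm_sqr x : enorm x ^+ 2 = dot x x.
Proof. by rewrite /enorm sqr_sqrtr ?dot_ge0. Qed.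

Lemma enorm_ge0 x : 0 <= enorm x.
Proof. exact: sqrtr_ge0. Qed.

Lemma enorm_ltP x (r : R) : 0 < r -> (enorm x < r) = (dot x x < r ^+ 2).
Proof.
by move=> r0; rewrite -enorm_sqr ltr_pXn2r// ?nnegrE ?enorm_ge0// ltW.
Qed.

Lemma dot_gt0 x : x != 0 -> 0 < dot x x.
Proof.
move=> x0; rewrite lt_neqAle dot_ge0 andbT eq_sym; apply: contraNneq x0.
move/eqP; rewrite psumr_eq0; last by move=> i _; rewrite -expr2 sqr_ge0.
move=> /allP H; apply/eqP/rowP => i; rewrite mxE.
by have := H i (mem_index_enum _); rewrite /= mulf_eq0 orbb => /eqP; rewrite ord1.
Qed.

Lemma entry_le_enorm x i : `|x ord0 i| <= enorm x.
Proof.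
rewrite -(@ler_pXn2r _ 2)// ?nnegrE ?enorm_ge0// enorm_sqr.
rewrite real_normK ?num_real// /dot (bigD1 i)//= -expr2 lerDl.
by apply: sumr_ge0 => j _; rewrite -expr2 sqr_ge0.
Qed.
End Dot.

Lemma delta_norm_le (R : realType) (n : nat) (i : 'I_n) :
  `|delta_mx ord0 i : 'rV[R]_n| <= 1.
Proof.
rewrite /Num.norm/= mx_normrE; apply/bigmax_leP; split=> // -[k l] _ /=.
by rewrite mxE; case: (_ && _); rewrite ?normr1 ?normr0.
Qed.

(** * The gradient of a convex function is a subgradient *)

Section Jensen.
Variables (R : realType) (n : nat) (C : set 'rV[R]_n) (f : 'rV[R]_n -> R).
Hypothesis segC : forall a b (s : R), C a -> C b -> 0 <= s <= 1 -> C (a + s *: (b - a)).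
Hypothesis seg : forall a b (s : R), C a -> C b -> 0 <= s <= 1 ->
  f (a + s *: (b - a)) <= f a + s * (f b - f a).

Lemma jensen_mean m (a : 'I_m -> 'rV[R]_n) : (0 < m)%N -> (forall i, C (a i)) ->
  C ((m%:R)^-1 *: \sum_(i < m) a i) /\
  f ((m%:R)^-1 *: \sum_(i < m) a i) <= (m%:R)^-1 * \sum_(i < m) f (a i).
Proof.
elim: m a => // -[_ a _ Ca|m IHm a _ Ca].
  by rewrite !big_ord_recr !big_ord0/= invr1 scale1r mul1r !add0r lexx.
have [//|IC IH] := IHm (fun i => a (widen_ord (leqnSn m.+1) i)) isT.
rewrite [\sum_(i < m.+2) a i]big_ord_recr [\sum_(i < m.+2) f (a i)]big_ord_recr/=.
set l := a ord_max; have Cl : C l by exact: Ca.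
set S := \sum_(i < m.+1) a _ in IC IH *; set T := \sum_(i < m.+1) f _ in IH *.
have m0 : (0 : R) < m.+1%:R by rewrite ltr0n.
have m20 : (0 : R) < m.+2%:R by rewrite ltr0n.
have mm : (m.+2%:R : R) = m.+1%:R + 1 by rewrite -natr1.
have w01 : 0 <= (m.+2%:R : R)^-1 <= 1.
  by rewrite invr_ge0 ler0n/= invf_le1// ler1n.
have E : (m.+2%:R)^-1 *: (S + l) =
    (m.+1%:R)^-1 *: S + (m.+2%:R)^-1 *: (l - (m.+1%:R)^-1 *: S).
  apply/rowP=> i; rewrite !mxE mm; field.
  by rewrite !gt_eqF// -mm.
rewrite E; split; first exact: segC.
apply: le_trans (seg IC Cl w01) _.
have -> : (m.+2%:R)^-1 * (T + f l) =
   (m.+1%:R)^-1 * T + (m.+2%:R)^-1 * (f l - (m.+1%:R)^-1 * T).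
  by rewrite mm; field; rewrite !gt_eqF// -mm.
set u := f (_ *: S) in IH *; set U := _ * T in IH *.
have aux (k p q r : R) : p <= q -> 0 <= k <= 1 -> p + k * (r - p) <= q + k * (r - q).
  by move=> pq /andP[k0 k1]; nra.
exact: aux.
Qed.

End Jensen.

Section ConvexFunction.
Variables (R : realType) (n : nat) (C : set 'rV[R]_n) (phi : 'rV[R]_n -> R^o).
Hypothesis segC : forall a b (s : R), C a -> C b -> 0 <= s <= 1 -> C (a + s *: (b - a)).
Hypothesis phic : convex_function (C : set (convex_lmodType 'rV[R]_n)) phi.

Lemma convex_function_segment a b (s : R) : C a -> C b -> 0 <= s <= 1 ->
  phi (a + s *: (b - a)) <= phi a + s * (phi b - phi a).
Proof.
move=> Ca Cb /andP[s0 s1].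
have := phic (Itv01 s0 s1) (mem_set Cb) (mem_set Ca).
rewrite /conv/= /unstable.onem => H.
have -> : a + s *: (b - a) = s *: b + (1 - s) *: a by rowring.
apply: le_trans H _; change (s * phi b + (1 - s) * phi a <= phi a + s * (phi b - phi a)); lra.
Qed.

Lemma derivable_linear_approx w i (e : R) : has_partial i phi w -> 0 < e ->
  exists2 d : R, 0 < d & forall h : R, `|h| < d ->
    `|phi (w + h *: delta_mx ord0 i) - phi w - h * partial i phi w| <= e * `|h|.
Proof.
move=> dw e0.
have /cvgrPdist_lt /(_ e e0) : (fun h : R => h^-1 *: (phi (h *: delta_mx ord0 i + w) - phi w)) @ (0:R)^' --> partial i phi w.
  exact: dw.
rewrite near_withinE => /nbhs_ballP[d /= d0 hd].
exists d => // h hh; have [->|h0] := eqVneq h 0.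
  by rewrite scale0r addr0 mul0r subrr subr0 normr0 mulr0.
have : ball (0 : R) d h by rewrite -ball_normE /ball_/= sub0r normrN.
move=> /hd /(_ h0) /ltW; rewrite /GRing.scale/= distrC.
rewrite [_ *: delta_mx _ _ + w]addrC => H.
have -> : phi (w + h *: delta_mx ord0 i) - phi w - h * partial i phi w =
  h * (h^-1 * (phi (w + h *: delta_mx ord0 i) - phi w) - partial i phi w).
  by field.
by rewrite normrM mulrC ler_wpM2r.
Qed.

(** With v = y - w, the point w is the midpoint of w + s v and of the mean of
    the n points w - n s v_i e_i.  Convexity bounds phi (w + s v) from below by the values
    at these points, which the partial derivatives give to first order in s,
    and bounds it from above on the segment from w to y. *)
Lemma grad_subgradient w y :
  (forall i, has_partial i phi w) -> (0 < n)%N ->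
  (exists2 e : R, 0 < e & forall u, `|u - w| < e -> C u) -> C y ->
  0 <= phi y - phi w - dot (grad phi w) (y - w).
Proof.
move=> dw n0 [e e0 he] Cy.
pose v := y - w; pose V := \sum_(i < n) `|v ord0 i|.
have V0 : 0 <= V by apply: sumr_ge0.
have Cw : C w by apply: he; rewrite subrr normr0.
have nr0 : 0 < n%:R :> R by rewrite ltr0n.
(* eta is the error allowed in the first-order expansions *)
suff H (eta : R) : 0 < eta -> - (eta * (V + 1)) <= phi y - phi w - dot (grad phi w) v.
  rewrite leNgt; apply/negP => neg.
  have := H (- (phi y - phi w - dot (grad phi w) v) / 2 / (V + 1)).
  rewrite divfK ?gt_eqF ?ltr_pwDr//.
  have p : 0 < - (phi y - phi w - dot (grad phi w) v) / 2 by lra.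
  rewrite divr_gt0 ?ltr_pwDr// => /(_ isT); lra.
move=> eta0.
have [d d0 hd] : exists2 d : R, 0 < d & forall i (h : R), `|h| < d ->
    `|phi (w + h *: delta_mx ord0 i) - phi w - h * partial i phi w| <= eta * `|h|.
  have /choice[dd hdd] : forall i, exists d : R, 0 < d /\ forall h : R, `|h| < d ->
    `|phi (w + h *: delta_mx ord0 i) - phi w - h * partial i phi w| <= eta * `|h|.
    by move=> i; have [d ? ?] := derivable_linear_approx (dw i) eta0; exists d.
  exists (\big[Num.min/1]_i dd i).
    by elim/big_ind: _ => [//|x z x0 z0|i _]; [rewrite lt_min x0|have [] := hdd i].
  move=> i h hh; have [_] := hdd i; apply; apply: lt_le_trans hh _.
  by rewrite (bigD1 i)//= ge_min lexx.
pose dl := Num.min d e.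
have dl0 : 0 < dl by rewrite lt_min d0.
(* the step s keeps the points w - n s v_i e_i within distance dl of w *)
pose s := Num.min (1 / 2) (dl / (2 * n%:R * (V + 1))).
have s0 : 0 < s by rewrite lt_min divr_gt0//= divr_gt0// !mulr_gt0// ltr_pwDr.
have s1 : s <= 1 by rewrite ge_min; apply/orP; left; lra.
have hs i : `|- (n%:R * s * v ord0 i)| < dl.
  rewrite normrN normrM gtr0_norm ?mulr_gt0//.
  have vi : `|v ord0 i| <= V by rewrite /V (bigD1 i)//= lerDl sumr_ge0.
  have : s <= dl / (2 * n%:R * (V + 1)) by rewrite ge_min lexx orbT.
  rewrite ler_pdivlMr; last by rewrite !mulr_gt0// ltr_pwDr.
  have : n%:R * s * `|v ord0 i| <= n%:R * s * (V + 1).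
    apply: ler_wpM2l; first by rewrite mulr_ge0 ?ler0n// ltW.
    by apply: (le_trans vi); rewrite lerDl.
  set q := n%:R * s * _; nra.
pose a (i : 'I_n) := w - (n%:R * s * v ord0 i) *: delta_mx ord0 i.
have Ca j : C (a j).
  apply: he; rename j into i.
  rewrite /a addrC addKr -scaleNr normrZ.
  have := delta_norm_le R i.
  have : dl <= e by rewrite ge_min lexx orbT.
  have := hs i; have := normr_ge0 (- (n%:R * s * v ord0 i)).
  set A := `|_|; set B := `|_|; nra.
have [Cm Hm] := jensen_mean segC convex_function_segment n0 Ca.
have mE : n%:R^-1 *: \sum_(i < n) a i = w - s *: v.
  apply/rowP => j; rewrite !mxE summxE.
  rewrite (eq_bigr (fun i => w ord0 j - n%:R * s * (v ord0 i * (i == j)%:R))); last first.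
    by move=> i _; rewrite !mxE eqxx/= [j == i]eq_sym; ring.
  rewrite sumrB sumr_const card_ord -mulr_sumr (bigD1 j)//= eqxx big1; last first.
    by move=> i /negbTE ->; rewrite mulr0.
  by rewrite -[w ord0 j *+ n]mulr_natl !mxE (_ : 0 = ord0)// (_ : (true : nat)%:R = 1 :> R)//; field; rewrite gt_eqF.
rewrite mE in Cm Hm.
have half : 0 <= (2^-1 : R) <= 1 by rewrite invr_ge0 invf_le1 ?ler0n// ler1n.
have Cs : C (w + s *: v) by apply: segC => //; rewrite ltW.
have := convex_function_segment Cm Cs half.
have -> : w - s *: v + 2^-1 *: (w + s *: v - (w - s *: v)) = w.
  by apply/rowP => i; rewrite !mxE; field.
have := convex_function_segment Cw Cy (_ : 0 <= s <= 1).
rewrite -/v ltW// s1 => /(_ isT).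
have sumle : n%:R^-1 * (\sum_(i < n) (phi (a i) : R)) <=
   (phi w : R) - s * dot (grad phi w) v + eta * s * V.
  rewrite ler_pdivrMl//.
  have -> : n%:R * ((phi w : R) - s * dot (grad phi w) v + eta * s * V) =
      \sum_(i < n) ((phi w : R) - n%:R * s * v ord0 i * partial i phi w
                    + eta * (n%:R * s * `|v ord0 i|)).
    rewrite big_split/= sumrB sumr_const card_ord -[_ *+ n in RHS]mulr_natl /V /dot.
    rewrite mulrDr mulrBr; congr (_ - _ + _); last first.
      by rewrite !mulr_sumr; apply: eq_bigr => i _; ring.
    rewrite !mulr_sumr; apply: eq_bigr => i _; rewrite mxE; ring.
  apply: ler_sum => i _; have lt_d : `|- (n%:R * s * v ord0 i)| < d.
    by apply: lt_le_trans (hs i) _; rewrite ge_min lexx.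
  have := hd i _ lt_d; rewrite scaleNr -/(a i) => H.
  have := le_trans (ler_norm _) H.
  rewrite normrN (normrM (n%:R * s)) gtr0_norm ?mulr_gt0//.
  set X := phi (a i); set Y := phi w; clear.
  move: X Y (partial i phi w) => X Y p H; rewrite -subr_ge0; rewrite -subr_ge0 in H; move: H; congr (0 <= _); ring.
move: Hm sumle.
rewrite -/v; set G := dot _ _.
have fin (p1 p2 p3 p4 S : R) : p1 <= S -> S <= p3 - s * G + eta * s * V ->
   p2 <= p3 + s * (p4 - p3) -> p3 <= p1 + 2^-1 * (p2 - p1) -> - (eta * (V + 1)) <= p4 - p3 - G.
  move=> h1 h2 h3 h4.
  have h5 : 0 <= s * (p4 - p3 - G + eta * V) by lra.
  rewrite pmulr_rge0// in h5; lra.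
move=> h1 h2 h3 h4; exact: fin h1 h2 h3 h4.
Qed.
End ConvexFunction.

(** * The excess over the tangent plane *)

Definition excess (R : realType) (n : nat) (Omega : set 'rV[R]_n)
    (phi : 'rV[R]_n -> R^o) (x y : 'rV[R]_n) : R :=
  (phi y : R) - (phi x : R) - dot (egrad Omega phi x) (y - x).

Definition engulfs (R : realType) (n : nat) (theta : R) (Omega : set 'rV[R]_n)
    (phi : 'rV[R]_n -> R^o) : Prop :=
  forall (x y : 'rV[R]_n) (t : R), closure Omega x -> 0 < t ->
    msection Omega phi x t y ->
    msection Omega phi x t `<=` msection Omega phi y (theta * t).

(** For f(s) = E(z, z + s v), engulfing gives s f'(s) <= (1 + theta) f(s); this
    ratio is chosen so that f at most doubles when s is divided by it. *)
Definition doubling_ratio (R : realType) (theta : R) : R :=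
  1 - (2 * (1 + theta))^-1.

Section Excess.
Variables (R : realType) (n : nat) (rho lambda Lambda : R) (Omega : set 'rV[R]_n)
  (phi : 'rV[R]_n -> R^o).
Hypothesis n0 : (0 < n)%N.
Hypothesis H : structural rho lambda Lambda Omega phi.
Local Notation C := (closure Omega).
Local Notation E := (excess Omega phi).

Lemma msectionE x t y : msection Omega phi x t y <-> C y /\ E x y < t.
Proof.
rewrite /msection /excess /=; split=> -[Cy h]; split=> //; lra.
Qed.

Lemma domain_segment a b (s : R) : C a -> C b -> 0 <= s <= 1 -> C (a + s *: (b - a)).
Proof. exact: closure_segment (dom_convex H) _ _ _. Qed.

Lemma phi_cvg_within x : C x -> phi @ within Omega (nbhs x) --> phi x.
Proof.
move=> Cx.
have [M [M0 hM]] : exists M : R, 0 < M /\ forall y, C y -> `|phi x - phi y| <= M * `|x - y|.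
  have [M [Mr hM]] := phi_lipschitz H.
  exists (`|M| + 1); split; first by rewrite ltr_pwDr.
  move=> y Cy; have lt : M < `|M| + 1 by apply: le_lt_trans (ler_norm _) _; rewrite ltrDl.
  by have := hM _ lt (x, y); apply.
apply/cvgrPdist_lt => e e0; rewrite near_withinE.
apply/nbhs_ballP; exists (e / M) => /=; first by rewrite divr_gt0.
move=> y; rewrite -ball_normE/= ltr_pdivlMr// => xy Oy.
by apply: le_lt_trans (hM y _) _; [exact: subset_closure|rewrite mulrC].
Qed.

(** At points of the domain this is the subgradient inequality; it passes to the
    closure because phi and its gradient extend continuously. *)
Lemma excess_ge0 x y : C x -> C y -> 0 <= E x y.
Proof.
move=> Cx Cy.
have pF : ProperFilter (within Omega (nbhs x)) by exact: within_nbhs_proper.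
have cg : grad phi @ within Omega (nbhs x) --> egrad Omega phi x by exact: grad_extends H x Cx.
have cf : (fun w => (phi y : R) - (phi w : R) - dot (grad phi w) (y - w)) @ within Omega (nbhs x) --> E x y.
  apply: cvgB; first by apply: cvgB; [exact: cvg_cst|exact: phi_cvg_within].
  rewrite /dot; apply: cvg_big => [|i _]; first exact: add_continuous.
  apply: cvgM.
    by by apply: (@cvg_comp _ _ _ (grad phi) (fun M : 'rV[R]_n => M ord0 i) _ _ _ cg); exact: coord_continuous.
  under eq_cvg do rewrite !mxE.
  rewrite !mxE; apply: cvgB; first exact: cvg_cst.
  apply: (@cvg_trans _ ((fun w : 'rV[R]_n => w ord0 i) @ nbhs x)).
    exact: cvg_within_filter.
  exact: coord_continuous.
apply: (cvgr_to_ge cf); rewrite near_withinE; near=> w => Ow.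
have [e e0 he] := open_norm_ball (dom_open H) Ow.
apply: (grad_subgradient domain_segment (phi_convex H)) => //.
  by move=> i; have [_ h _] := phi_C2 H Ow; have [] := h i.
by exists e => // u /he; exact: subset_closure.
Unshelve. all: by end_near.
Qed.

Lemma phi_segment a b (s : R) : C a -> C b -> 0 <= s <= 1 ->
  (phi (a + s *: (b - a)) : R) <= (phi a : R) + s * ((phi b : R) - (phi a : R)).
Proof. move=> Ca Cb s01. exact: (convex_function_segment (phi_convex H) Ca Cb s01). Qed.

Lemma excess_segment z a b (s : R) : C a -> C b -> 0 <= s <= 1 ->
  E z (a + s *: (b - a)) <= E z a + s * (E z b - E z a).
Proof.
move=> Ca Cb s01; have := phi_segment Ca Cb s01.
rewrite /excess; move: (egrad _ _ z) => gz; rewrite !dotE.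
lra.
Qed.

Lemma excess_xx x : E x x = 0.
Proof. by rewrite /excess dotBr !subrr. Qed.

Lemma excess_ray z b (s : R) : C z -> C b -> 0 <= s <= 1 ->
  E z (z + s *: (b - z)) <= s * E z b.
Proof. by move=> Cz Cb s01; have := excess_segment z Cz Cb s01; rewrite excess_xx; lra. Qed.

(** The left-hand side equals E(x, b) + E(z, c) - E(z, b) - E(x, c).  It controls
    the oscillation of the gradient by the excess alone, up to the boundary. *)
Lemma three_point x z b c : C x -> C z -> C b -> C c ->
  dot (egrad Omega phi z - egrad Omega phi x) (b - c) <= E x b + E z c.
Proof.
move=> Cx Cz Cb Cc; have := excess_ge0 Cz Cb; have := excess_ge0 Cx Cc.
rewrite /excess; move: (egrad _ _ x) (egrad _ _ z) => gx gz; rewrite !dotE; lra.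
Qed.

Variable theta : R.
Hypothesis theta1 : 1 < theta.
Let theta0 : 0 < theta. Proof. exact: lt_trans theta1. Qed.
Hypothesis eng : engulfs theta Omega phi.

(** Both y and w belong to the section of x with height t, which is contained in
    the section of y with height theta t. *)
Lemma engulf_lt x y w t : C x -> C y -> C w ->
  E x y < t -> E x w < t -> E y w < theta * t.
Proof.
move=> Cx Cy Cw xy xw; have t0 : 0 < t by apply: le_lt_trans xy; exact: excess_ge0.
have /msectionE[] // := eng Cx t0 (iffRL (msectionE _ _ _) (conj Cy xy)) (iffRL (msectionE _ _ _) (conj Cw xw)).
Qed.

Lemma engulf x y w t : C x -> C y -> C w ->
  E x y <= t -> E x w <= t -> E y w <= theta * t.
Proof.
move=> Cx Cy Cw xy xw; apply/ler_addgt0Pr => e e0.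
have d0 : 0 < e / theta by rewrite divr_gt0.
have -> : theta * t + e = theta * (t + e / theta) by field; rewrite gt_eqF.
by apply/ltW/(engulf_lt Cx) => //; lra.
Qed.

Lemma excess_sym x y : C x -> C y -> E y x <= theta * E x y.
Proof. by move=> Cx Cy; apply: (@engulf x) => //; rewrite excess_xx excess_ge0. Qed.

Local Notation k := (doubling_ratio theta).

(** With u the intermediate point, E(w, u) >= 0 bounds E(z, w) - E(z, u) by
    (1 - k) (E(z, w) + E(w, z)), and E(w, z) <= theta E(z, w). *)
Lemma excess_doubling z w : C z -> C w -> E z w <= 2 * E z (z + k *: (w - z)).
Proof.
move=> Cz Cw; have th1 := theta1.
have k0 : 0 < (2 * (1 + theta))^-1 by rewrite invr_gt0; lra.
have k1 : (2 * (1 + theta))^-1 <= 1 by rewrite invf_le1; lra.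
have Cu : C (z + k *: (w - z)) by apply: domain_segment => //; rewrite /doubling_ratio; lra.
have := excess_ge0 Cw Cu; have := excess_sym Cz Cw; have := excess_ge0 Cz Cw.
have ke : 2 * (1 - k) * (1 + theta) = 1 by rewrite /doubling_ratio; field; lra.
have k1' : 0 <= 1 - k by rewrite /doubling_ratio; lra.
rewrite /excess; move: (egrad _ _ z) (egrad _ _ w) => gz gw; rewrite !dotE.
set a := dot _ z; set b := dot _ w; set c := dot _ z; set d := dot _ w.
set fu : R := phi (z + _); move: (phi z : R) (phi w : R) fu => fz fw fu.
set X := fw - fz - (b - a).
move=> X0 h1 h2.
have h3 : (1 - k) * (X + (fz - fw - (c - d))) <= X / 2.
  have -> : X / 2 = (1 - k) * ((1 + theta) * X).
    have e2 : (1 - k) * (1 + theta) = 2^-1 by lra.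
    by rewrite mulrA e2 mulrC.
  by rewrite ler_wpM2l// mulrDl mul1r lerD2l.
rewrite /X in h3 *; lra.
Qed.

(** Iterating [excess_doubling]: the excess grows at most like r^p along a ray.
    The exponent p is any integer for which p shrinkings by the doubling ratio
    amount to a halving; the factor 2 accounts for the incomplete last step. *)
Lemma excess_growth p z y (r : R) : 2 * k ^+ p <= 1 -> C z -> 1 <= r ->
  C (z + r *: (y - z)) -> E z (z + r *: (y - z)) <= 2 * r ^+ p * E z y.
Proof.
move=> kp Cz r1 Cr; have th1 := theta1.
have k0 : 0 < k by rewrite /doubling_ratio subr_gt0 invf_lt1; lra.
have k1 : k < 1 by rewrite /doubling_ratio ltrBlDr ltrDl invr_gt0; lra.
have Cseg s r' : C (z + r' *: (y - z)) -> 0 <= s <= 1 -> C (z + (s * r') *: (y - z)).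
  move=> Cr' s01; have := domain_segment Cz Cr' s01; congr closure.
  by apply/rowP=> i; rewrite !mxE; ring.
have Cy : C y.
  have r0 : 0 < r by lra.
  have := Cseg r^-1 r Cr; rewrite mulVf ?gt_eqF// scale1r addrC subrK; apply.
  by rewrite invr_ge0 ltW// invf_le1.
have E0 := excess_ge0 Cz Cy.
have [m] : exists m, r * k ^+ m <= 1.
  have nk : `|k| < 1 by rewrite gtr0_norm.
  have /cvgrPdist_lt /(_ r^-1) := cvg_expr nk.
  have r0 : 0 < r by lra.
  rewrite invr_gt0 => /(_ r0) [m _ /(_ m (leqnn m))].
  rewrite /= sub0r normrN ger0_norm ?exprn_ge0 ?ltW//.
  by rewrite -[r^-1]mul1r ltr_pdivlMr// mulrC => /ltW; exists m.
elim: m r r1 Cr => [|m IH] r r1 Cr hm.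
  have -> : r = 1 by apply/eqP; rewrite eq_le r1 -[r]mulr1 hm.
  by rewrite expr1n mulr1 scale1r addrC subrK; lra.
have rp : 1 <= r ^+ p by rewrite exprn_ege1.
have Er := excess_doubling Cz Cr.
have kE : z + k *: (z + r *: (y - z) - z) = z + (k * r) *: (y - z) by rowring.
rewrite kE in Er.
have [kr1|kr1] := lerP (k * r) 1.
  have kr01 : 0 <= k * r <= 1 by rewrite kr1 mulr_ge0//; lra.
  have := excess_ray Cz Cy kr01 => H2.
  have H3 : k * r * E z y <= r ^+ p * E z y by rewrite ler_wpM2r//; lra.
  rewrite -mulrA; lra.
have k01 : 0 <= k <= 1 by rewrite !ltW.
have Ckr := Cseg k r Cr k01.
have hmk : (k * r) * k ^+ m <= 1 by rewrite mulrAC -exprS mulrC.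
have := IH _ (ltW kr1) Ckr hmk => H2.
apply: le_trans Er _.
apply: (@le_trans _ _ (2 * (2 * (k * r) ^+ p * E z y))); first by rewrite ler_wpM2l.
rewrite exprMn.
have -> : 2 * (2 * (k ^+ p * r ^+ p) * E z y) = (2 * k ^+ p) * (2 * r ^+ p * E z y) by ring.
apply: ler_piMl => //; rewrite mulr_ge0//; lra.
Qed.
End Excess.

(** * Boundary geometry of the domain *)

Section Geometry.
Variables (R : realType) (n : nat) (rho lambda Lambda : R) (Omega : set 'rV[R]_n)
  (phi : 'rV[R]_n -> R^o).
Hypothesis n0 : (0 < n)%N.
Hypothesis rho0 : 0 < rho.
Hypothesis H : structural rho lambda Lambda Omega phi.
Local Notation C := (closure Omega).
Local Notation E := (excess Omega phi).

Lemma closure_entry x i : C x -> `|x ord0 i| <= rho^-1.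
Proof.
move=> Cx; apply/ler_addgt0Pr => e e0.
have [y Oy yx] := closure_norm Cx e0.
have h1 : `|y ord0 i| <= rho^-1.
  by apply: le_trans (entry_le_enorm y i) _; have := dom_bounded H Oy; rewrite /eball/= subr0 => /ltW.
have h2 : `|(y - x) ord0 i| <= `|y - x|.
  by rewrite {2}/Num.norm/= mx_normrE; apply: (le_bigmax _ (fun i => `|(y - x) i.1 i.2|) (ord0, i)).
have -> : x ord0 i = y ord0 i - (y - x) ord0 i by rewrite !mxE; ring.
apply: le_trans (ler_normB _ _) _; lra.
Qed.

Definition dom_diam2 : R := n%:R * (2 / rho) ^+ 2.

Lemma dom_diam2_ge0 : 0 <= dom_diam2.
Proof. by rewrite mulr_ge0 ?sqr_ge0. Qed.

Lemma closure_dist x y : C x -> C y -> dot (x - y) (x - y) <= dom_diam2.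
Proof.
move=> Cx Cy; rewrite /dot /dom_diam2.
have -> : n%:R * (2 / rho) ^+ 2 = \sum_(i < n) (2 / rho) ^+ 2.
  by rewrite sumr_const card_ord -[RHS]mulr_natl.
apply: ler_sum => i _; rewrite -expr2 -real_normK ?num_real//.
have h : `|(x - y) ord0 i| <= 2 / rho.
  rewrite !mxE; apply: le_trans (ler_normB _ _) _.
  have := closure_entry i Cx; have := closure_entry i Cy; lra.
by rewrite !expr2 ler_pM.
Qed.

Lemma leaves_domain x y : C x -> x != y -> exists2 m : R, 1 < m & ~ Omega (x + m *: (y - x)).
Proof.
move=> Cx xy; have d0 : 0 < dot (y - x) (y - x) by rewrite dot_gt0// subr_eq0 eq_sym.
set d := dot _ _ in d0.
have D0 : 0 <= dom_diam2 / d by rewrite divr_ge0 ?dom_diam2_ge0 ?ltW.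
exists (2 + dom_diam2 / d); first lra.
move=> Oe; have := closure_dist (subset_closure Oe) Cx.
rewrite addrC addKr !(dotZl, dotZr) -/d => h.
have e : dom_diam2 = (dom_diam2 / d) * d by rewrite divfK// gt_eqF.
move: h; rewrite {3}e mulrA ler_pM2r//; move: (dom_diam2 / d) D0 => q q0; nra.
Qed.

Lemma bdry_nonempty : exists q, bdry Omega q.
Proof.
have [c Oc] := dom_nonempty H.
have ne : c != c + delta_mx ord0 (Ordinal n0).
  apply/eqP => /rowP/(_ (Ordinal n0)); rewrite !mxE !eqxx/= => /eqP.
  by rewrite -subr_eq0 opprD addNKr oppr_eq0 oner_eq0.
have [m _ No] := leaves_domain (subset_closure Oc) ne.
have [s _ bs] := exit_point (dom_open H) (subset_closure Oc) No.
by eexists; exact: bs.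
Qed.

Lemma bdry_excess_le x y : bdry Omega x -> bdry Omega y ->
  rho * dot (y - x) (y - x) <= E x y <= rho^-1 * dot (y - x) (y - x).
Proof. by move=> bx yx; have := quad_separation H yx bx; rewrite enorm_sqr. Qed.

(** The point y lies on a segment from q to another boundary point, where the
    excess is bounded by quadratic separation, and the excess is convex. *)
Lemma excess_le_bdry q y : bdry Omega q -> C y -> E q y <= rho^-1 * dom_diam2.
Proof.
move=> bq Cy; have [Cq _] := (bdryP (dom_open H) q).1 bq.
have T0 : 0 <= rho^-1 * dom_diam2.
  by rewrite mulr_ge0 ?dom_diam2_ge0// invr_ge0 ltW.
have [->|qy] := eqVneq y q; first by rewrite excess_xx.
have qy' : q != y by rewrite eq_sym.
have [m m1 No] := leaves_domain Cq qy'.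
have [s /andP[s0 s1] bp] := exit_point (dom_open H) Cy No.
set p := y + _ in bp.
have r1 : 1 <= 1 + s * (m - 1) by rewrite lerDl mulr_ge0//; lra.
set r := 1 + _ in r1.
have pE : p = q + r *: (y - q) by rewrite /p /r; rowring.
have r0 : 0 < r by lra.
have yE : y = q + r^-1 *: (p - q).
  by rewrite pE; apply/rowP => i; rewrite !mxE; field; rewrite gt_eqF.
have [Cp _] := (bdryP (dom_open H) p).1 bp.
have r01 : 0 <= r^-1 <= 1 by rewrite invr_ge0 ltW// invf_le1.
have Ep : E q p <= rho^-1 * dom_diam2.
  have /andP[_ h] := bdry_excess_le bq bp; apply: le_trans h _.
  by rewrite ler_pM2l ?invr_gt0// closure_dist.
rewrite yE; apply: le_trans (excess_ray H Cq Cp r01) _.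
have E0 := excess_ge0 n0 H Cq Cp.
by apply: le_trans Ep; apply: ler_piMl => //; case/andP: r01.
Qed.

(** The point Q + m (P - Q) lies beyond P on the line through the chord, hence
    outside the domain.  Shifting it towards the centre c of the ball tangent
    at Q, by an amount quadratic in its distance to Q, brings it into the ball
    because the chord points inward.  The boundary is crossed in between. *)
Lemma tangent_chord P Q (m : R) : bdry Omega P -> bdry Omega Q -> 1 < m ->
  0 < dot (P - Q) (P - Q) -> m ^+ 2 * dot (P - Q) (P - Q) < rho ^+ 2 ->
  exists p c s, [/\ bdry Omega p, C c, 0 <= s <= 1,
    p = Q + m *: (P - Q) + (s * (m ^+ 2 * dot (P - Q) (P - Q) / rho ^+ 2)) *: (c - Q) &
    dot (p - Q) (p - Q) <= 4 * (m ^+ 2 * dot (P - Q) (P - Q))].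
Proof.
move=> bP bQ m1; have rh0 := rho0.
set u := P - Q => u0; set r2 := _ * _ => r2rho.
have [CP NP] := (bdryP (dom_open H) P).1 bP.
have [CQ NQ] := (bdryP (dom_open H) Q).1 bQ.
have [c cO Qc] := interior_ball H bQ.
have cc : dot (c - Q) (c - Q) = rho ^+ 2.
  by rewrite -Qc enorm_sqr -[Q - c]opprB dotNl dotNr opprK.
have r20 : 0 < r2 by rewrite mulr_gt0// exprn_gt0//; lra.
have rr0 : 0 < rho ^+ 2 by rewrite exprn_gt0.
(* The chord points to the inner side of the tangent plane: otherwise its
   prolongation beyond Q would enter the ball, and Q would be interior. *)
have k0 : 0 <= dot u (c - Q).
  rewrite leNgt; apply/negP => neg; apply: NQ.
  pose k := - dot u (c - Q) / (dot u u + 1).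
  have kk : 0 < k by rewrite divr_gt0//; lra.
  have kE : k * (dot u u + 1) = - dot u (c - Q) by rewrite divfK// gt_eqF//; lra.
  have Oa : Omega (Q - k *: u).
    apply: cO; rewrite /eball /= enorm_ltP//.
    have -> : Q - k *: u - c = (- k) *: u + (- 1) *: (c - Q) by rowring.
    rewrite dot_comb_sqr cc; move: (dot u u) (dot u (c - Q)) u0 neg kE => U W u0 neg kE.
    have : k * (k * U + 2 * W) < 0 by rewrite pmulr_rlt0//; lra.
    by lra.
  have := interior_segment (dom_open H) (dom_convex H) Oa CP (_ : 0 <= k / (1 + k) < 1).
  have k10 : 0 < 1 + k by lra.
  rewrite divr_ge0 ?ltW//= ltr_pdivrMr// mul1r ltrDr ltr01 => /(_ isT).
  congr Omega; rewrite /u; apply/rowP => i; rewrite !mxE; field; rewrite gt_eqF//.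
have Ne := outside_beyond (dom_open H) (dom_convex H) CQ bP m1.
have Ob : Omega (Q + m *: u + (r2 / rho ^+ 2) *: (c - Q)).
  apply: cO; rewrite /eball /= enorm_ltP//.
  have -> : Q + m *: u + (r2 / rho ^+ 2) *: (c - Q) - c =
     m *: u + (r2 / rho ^+ 2 - 1) *: (c - Q) by rowring.
  rewrite dot_comb_sqr cc -/r2; move: (dot u (c - Q)) k0 => W k0.
  set q := r2 / rho ^+ 2; have qE : r2 = q * rho ^+ 2 by rewrite divfK// gt_eqF.
  have q0 : 0 < q by rewrite divr_gt0.
  have q1 : q < 1 by rewrite ltr_pdivrMr// mul1r.
  have h1 : 2 * m * (q - 1) * W <= 0.
    by rewrite -mulrA mulr_ge0_le0//; [lra|rewrite mulr_le0_ge0//; lra].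
  have : rho ^+ 2 * (q * (q - 1)) < 0 by rewrite !pmulr_rlt0//; lra.
  rewrite {1}qE; lra.
have [s s01 bp] := exit_point (dom_open H) (subset_closure Ob) Ne.
exists (Q + m *: u + ((1 - s) * (r2 / rho ^+ 2)) *: (c - Q)), c, (1 - s).
have /andP[s0 s1] := s01.
split.
- by move: bp; congr bdry; rewrite /u; rowring.
- by apply: subset_closure; apply: cO; rewrite /eball/= subrr enorm_ltP// /dot big1 ?exprn_gt0// => i _; rewrite mxE mul0r.
- by lra.
- by [].
- set q := r2 / rho ^+ 2; have qE : r2 = q * rho ^+ 2 by rewrite divfK// gt_eqF.
  have q0 : 0 < q by rewrite divr_gt0.
  have q1 : q < 1 by rewrite ltr_pdivrMr// mul1r.
  have -> : Q + m *: u + ((1 - s) * q) *: (c - Q) - Q =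
    m *: u + ((1 - s) * q) *: (c - Q) by rowring.
  have h1 : dot (m *: u + ((1 - s) * q) *: (c - Q)) (m *: u + ((1 - s) * q) *: (c - Q))
    <= 2 * r2 + 2 * (((1 - s) * q) ^+ 2 * rho ^+ 2).
    have := dot_ge0 (m *: u + (- ((1 - s) * q)) *: (c - Q)).
    rewrite !dot_comb_sqr cc -/r2; lra.
  apply: le_trans h1 _.
  have h2 : ((1 - s) * q) ^+ 2 <= q.
    apply: (@le_trans _ _ ((1 - s) * q)); last by apply: ler_piMl; lra.
    rewrite expr2; apply: ler_piMl; first by rewrite mulr_ge0//; lra.
    by rewrite mulr_ile1//; lra.
  have := ler_wpM2r (ltW rr0) h2; rewrite -qE; lra.
Qed.
End Geometry.

(** * Hoelder continuity of the excess in its second variable *)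

Section Hoelder.
Variables (R : realType) (n : nat) (rho theta : R) (p : nat).
Hypothesis n0 : (0 < n)%N.
Hypothesis rho0 : 0 < rho.
Hypothesis theta1 : 1 < theta.
Hypothesis p2 : (2 <= p)%N.
Hypothesis kp : 2 * doubling_ratio theta ^+ p <= 1.

(** Quadratic separation bounds the excess from boundary points, and engulfing
    then bounds it from every point, at the cost of a factor theta. *)
Definition max_excess : R := theta * (rho^-1 * dom_diam2 n rho).
(** The auxiliary boundary point is taken at squared distance [chord_scale] * t
    from Q, which stays below rho^2 for all heights t up to [max_excess]. *)
Definition chord_scale : R := rho ^+ 2 / (max_excess + 1).
(** Lower bound for the stretching factor of y - z divided by 1 / d. *)
Definition hoelder_low : R := Num.min 1 (rho * chord_scale / (2 * theta ^+ 3)).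
(** The endpoints of the chord are at excess at most [hoelder_wide] * t from z. *)
Definition hoelder_wide : R := 2 * theta ^+ 2 * 2 ^+ p.
Definition hoelder_cst : R :=
  3 * theta ^+ 2 + ((1 + theta) * hoelder_wide +
   theta ^+ 2 * (theta * hoelder_wide + 4 * chord_scale / rho) + hoelder_wide + 2) / hoelder_low + 1.

Let theta0 : 0 < theta. Proof. exact: lt_trans theta1. Qed.

Lemma max_excess_ge0 : 0 <= max_excess.
Proof.
by rewrite mulr_ge0 ?(ltW theta0)// mulr_ge0 ?invr_ge0 ?(ltW rho0)// dom_diam2_ge0.
Qed.

Lemma chord_scale_gt0 : 0 < chord_scale.
Proof. by rewrite divr_gt0 ?exprn_gt0// ltr_pwDr// max_excess_ge0. Qed.

Lemma chord_scale_max t : 0 <= t <= max_excess -> chord_scale * t < rho ^+ 2.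
Proof.
move=> /andP[t0 tT]; rewrite /chord_scale mulrAC ltr_pdivrMr; last first.
  by rewrite ltr_pwDr// max_excess_ge0.
by rewrite ltr_pM2l ?exprn_gt0//; lra.
Qed.

Lemma hoelder_low_gt0 : 0 < hoelder_low.
Proof.
rewrite lt_min ltr01/=; apply: divr_gt0; first by rewrite mulr_gt0// chord_scale_gt0.
by rewrite mulr_gt0// exprn_gt0.
Qed.

Lemma hoelder_cst_ge : 3 * theta ^+ 2 <= hoelder_cst - 1.
Proof.
have th0 := theta0; have k0 := chord_scale_gt0; have c0 := hoelder_low_gt0.
rewrite /hoelder_cst addrK lerDl; apply: mulr_ge0; last by rewrite invr_ge0 ltW.
have B0 : 0 <= hoelder_wide.
  by apply/ltW/mulr_gt0; [apply: mulr_gt0; rewrite ?exprn_gt0|rewrite exprn_gt0].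
have k0' : 0 <= 4 * chord_scale / rho by apply/ltW/divr_gt0 => //; exact: mulr_gt0.
have th0' := ltW th0.
rewrite !addr_ge0//; apply: mulr_ge0 => //; [by lra|exact: sqr_ge0|].
by apply: addr_ge0 => //; exact: mulr_ge0.
Qed.

Lemma pow_ge_low (X : R) : 0 <= X -> rho * chord_scale / (2 * theta ^+ 3) <= X ^+ p ->
  hoelder_low <= X.
Proof.
move=> X0 h; rewrite leNgt; apply/negP; rewrite lt_min => /andP[X1 Xc].
have : X ^+ p <= X.
  rewrite -(subnK (ltnW p2)) addn1 exprS; apply: ler_piMr => //.
  by rewrite exprn_ile1// ltW.
lra.
Qed.

Variables (lambda Lambda : R) (Omega : set 'rV[R]_n) (phi : 'rV[R]_n -> R^o).
Hypothesis H : structural rho lambda Lambda Omega phi.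
Hypothesis eng : engulfs theta Omega phi.
Local Notation C := (closure Omega).
Local Notation E := (excess Omega phi).
Local Notation g := (egrad Omega phi).
Local Notation engulfE := (engulf n0 H theta1 eng).

Lemma excess_le x y : C x -> C y -> E x y <= max_excess.
Proof.
move=> Cx Cy; have [q bq] := bdry_nonempty n0 H.
have [Cq _] := (bdryP (dom_open H) q).1 bq.
by apply: (engulfE Cq) => //; exact: excess_le_bdry H _ _ _ _.
Qed.

(** The case where the segment from z to y leaves the domain on both sides before
    being prolonged by a factor 1 / d; l is the ratio of the chord length to
    |y - z|.  With L2 the squared length of the chord, quadratic separation and
    the growth of the excess give rho L2 <= 2 theta^3 (l d)^p t.  Prolonging
    the chord by a further factor m >= 1 with m^2 L2 >= kappa t, where kappa is
    [chord_scale], therefore yields (l m d)^p >= c m^(p - 2), so that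
    1 / (l m) = O(d) because p >= 2.  Here m = 1 if L2 >= kappa t, and otherwise
    m^2 L2 = kappa t, which is the situation of [tangent_chord]. *)
Lemma hoelder_chord x y z (d t l : R) P Q : C x -> C y -> C z ->
  0 < t <= max_excess -> 0 < d -> 1 <= l <= 2 / d ->
  E x z <= t -> bdry Omega P -> bdry Omega Q ->
  P - Q = l *: (y - z) -> y != z ->
  E z P <= 2 * theta * (l * d) ^+ p * t ->
  E y Q <= 2 * theta * (l * d) ^+ p * t ->
  E y z <= 2 * theta * (l * d) ^+ p * t ->
  dot (g z - g x) (y - z) <= (hoelder_cst - 1) * d * t.
Proof.
move=> Cx Cy Cz /andP[t0 tT] d0 /andP[l1 ld] xz bP bQ PQE yz.
set ta := _ * t => zP yQ yzt.
have th0 := theta0; have th1 := theta1; have rh0 := rho0.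
have [CP NP] := (bdryP (dom_open H) P).1 bP.
have [CQ NQ] := (bdryP (dom_open H) Q).1 bQ.
have l0 : 0 < l by lra.
have ld0 : 0 < l * d by rewrite mulr_gt0.
have ld2 : l * d <= 2 by rewrite -ler_pdivlMr.
have ta0 : 0 < ta by rewrite !mulr_gt0// exprn_gt0.
have taB : theta * ta <= hoelder_wide * t.
  rewrite /ta /hoelder_wide.
  have -> : theta * (2 * theta * (l * d) ^+ p * t) = 2 * theta ^+ 2 * t * (l * d) ^+ p by ring.
  have -> : 2 * theta ^+ 2 * 2 ^+ p * t = 2 * theta ^+ 2 * t * 2 ^+ p by ring.
  rewrite ler_pM2l ?mulr_gt0 ?exprn_gt0//.
  by apply: lerXn2r; rewrite ?nnegrE ?(ltW ld0).
have zQ : E z Q <= theta * ta by apply: (engulfE Cy).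
have zP' : E z P <= theta * ta by apply: (le_trans zP); apply: ler_peMl; rewrite ltW.
have QP : E Q P <= theta * (theta * ta) by apply: (engulfE Cz).
have B1 : theta <= hoelder_wide.
  rewrite /hoelder_wide expr2.
  have : (1 : R) <= 2 ^+ p by rewrite exprn_ege1//; lra.
  have : 1 * theta <= theta * theta by rewrite ler_pM2r// ltW.
  move: (theta * theta) (2 ^+ p : R) => X Y hX hY; nra.
have zx : E z x <= hoelder_wide * t.
  apply: le_trans (excess_sym n0 H theta1 eng Cx Cz) _.
  apply: (@le_trans _ _ (theta * t)); first by rewrite ler_pM2l.
  by rewrite ler_pM2r.
have xP : E x P <= theta * (hoelder_wide * t) by apply: (engulfE Cz) => //; apply: le_trans taB.
set u := P - Q; set L2 := dot u u.
have u0 : u != 0 by rewrite /u PQE scaler_eq0 gt_eqF//= subr_eq0.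
have L20 : 0 < L2 by rewrite dot_gt0.
have hL : rho * L2 <= 2 * theta ^+ 3 * (l * d) ^+ p * t.
  have /andP[h _] := bdry_excess_le H bQ bP; apply: le_trans h _; apply: le_trans QP _.
  by rewrite /ta le_eqVlt; apply/orP; left; apply/eqP; ring.
have yzE : y - z = l^-1 *: u by rewrite /u PQE scalerA mulVf ?gt_eqF// scale1r.
have c0 := hoelder_low_gt0; have k0 := chord_scale_gt0.
have k0' : 0 <= 4 * chord_scale / rho by apply/ltW/divr_gt0 => //; exact: mulr_gt0.
have kt0 : 0 < chord_scale * t by exact: mulr_gt0.
have B0 : 0 < hoelder_wide by apply: lt_le_trans B1.
have th3 : 0 < 2 * theta ^+ 3 by rewrite mulr_gt0// exprn_gt0.
(* the factor m beyond the chord costs m^2 <= m^p in the separation bound *)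
have inv_low (m : R) : 1 <= m -> chord_scale * t <= m ^+ 2 * L2 -> (l * m)^-1 <= d / hoelder_low.
  move=> m1 hm; have m0 : 0 < m by lra.
  have : hoelder_low <= l * d * m.
    apply: pow_ge_low; first by rewrite mulr_ge0// ltW.
    rewrite ler_pdivrMr// -(ler_pM2r t0).
    have h1 : rho * (chord_scale * t) <= m ^+ 2 * (2 * theta ^+ 3 * (l * d) ^+ p * t).
      apply: (@le_trans _ _ (m ^+ 2 * (rho * L2))); last first.
        by rewrite ler_pM2l// exprn_gt0.
      have -> : m ^+ 2 * (rho * L2) = rho * (m ^+ 2 * L2) by ring.
      by rewrite ler_pM2l.
    rewrite -[rho * _ * t]mulrA; apply: le_trans h1 _.
    have -> : (l * d * m) ^+ p * (2 * theta ^+ 3) * t = m ^+ p * (2 * theta ^+ 3 * (l * d) ^+ p * t).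
      by rewrite exprMn; ring.
    rewrite ler_pM2r; last by rewrite !mulr_gt0 ?exprn_gt0.
    by rewrite ler_weXn2l.
  move=> h; rewrite -[_^-1]mul1r ler_pdivrMr ?mulr_gt0//.
  by rewrite mulrAC ler_pdivlMr// mul1r mulrA [d * l]mulrC.
pose A1 := (1 + theta) * hoelder_wide.
pose A2 := theta ^+ 2 * (theta * hoelder_wide + 4 * chord_scale / rho) + hoelder_wide + 2.
have A10 : 0 <= A1 by apply: mulr_ge0; lra.
have A20 : 0 <= A2.
  have hh : 0 <= theta * hoelder_wide by apply/ltW/mulr_gt0.
  have : 0 <= theta ^+ 2 * (theta * hoelder_wide + 4 * chord_scale / rho).
    by apply: mulr_ge0; [exact: sqr_ge0|exact: addr_ge0].
  by move=> h; rewrite /A2 !addr_ge0// ltW.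
have fin (i a : R) : i <= d / hoelder_low -> 0 <= i -> a <= A1 + A2 -> i * (a * t) <= (hoelder_cst - 1) * d * t.
  move=> h1 i0 h2; apply: (@le_trans _ _ (d / hoelder_low * ((A1 + A2) * t))).
    apply: (@le_trans _ _ (i * ((A1 + A2) * t))).
      by apply: ler_wpM2l => //; rewrite ler_pM2r.
    by apply: ler_wpM2r => //; apply: mulr_ge0; [exact: addr_ge0|exact: ltW].
  have -> : (hoelder_cst - 1) * d * t =
     3 * theta ^+ 2 * d * t + d / hoelder_low * ((A1 + A2) * t).
    by rewrite /hoelder_cst /A1 /A2; field; rewrite !gt_eqF.
  by rewrite lerDr !mulr_ge0// ltW.
have [big|small] := lerP (chord_scale * t) L2.
  rewrite yzE dotZr.
  have h := three_point n0 H Cx Cz CP CQ.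
  apply: (@le_trans _ _ (l^-1 * (A1 * t))).
    rewrite ler_pM2l ?invr_gt0//; apply: le_trans h _.
    by rewrite /A1; apply: le_trans (lerD xP (le_trans zQ taB)) _; lra.
  apply: fin; rewrite ?invr_ge0 ?(ltW l0)//; last by lra.
  by rewrite -[l]mulr1; apply: inv_low => //; rewrite expr1n mul1r.
(* Short chord: prolong it to length sqrt (chord_scale * t). *)
pose m := Num.sqrt (chord_scale * t / L2).
have m2 : m ^+ 2 * L2 = chord_scale * t.
  by rewrite sqr_sqrtr ?divr_ge0 ?(ltW kt0) ?(ltW L20)// divfK// gt_eqF.
have m1 : 1 < m.
  rewrite -(@ltr_pXn2r _ 2)// ?nnegrE ?sqrtr_ge0// expr1n.
  by rewrite -(ltr_pM2r L20) m2 mul1r.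
have hm : m ^+ 2 * L2 < rho ^+ 2 by rewrite m2 chord_scale_max// (ltW t0).
have [b [c [s [bb Cc /andP[s0 s1] bE bd]]]] := tangent_chord rho0 H bP bQ m1 L20 hm.
have [Cb _] := (bdryP (dom_open H) b).1 bb.
rewrite -/u -/L2 m2 in bE bd.
set sg := s * _ in bE.
have m0 : 0 < m by lra.
have yzE2 : y - z = (l * m)^-1 *: ((b - Q) + sg *: (Q - c)).
  rewrite yzE bE; apply/rowP => i; rewrite !mxE; field.
  by rewrite !gt_eqF.
have Qb : E Q b <= (theta * hoelder_wide + 4 * chord_scale / rho) * t.
  have /andP[_ h] := bdry_excess_le H bQ bb; apply: le_trans h _.
  apply: (@le_trans _ _ (rho^-1 * (4 * (chord_scale * t)))); first by rewrite ler_pM2l ?invr_gt0.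
  have : 0 <= theta * hoelder_wide * t by apply/ltW/mulr_gt0 => //; exact: mulr_gt0.
  have -> : rho^-1 * (4 * (chord_scale * t)) = 4 * chord_scale / rho * t by field; rewrite gt_eqF.
  by rewrite mulrDl; lra.
have Qz : E Q z <= (theta * hoelder_wide + 4 * chord_scale / rho) * t.
  apply: le_trans (excess_sym n0 H theta1 eng Cz CQ) _.
  apply: (@le_trans _ _ (theta * (hoelder_wide * t))); first by rewrite ler_pM2l// (le_trans zQ).
  have : 0 <= 4 * chord_scale / rho * t by apply: mulr_ge0 => //; exact: ltW.
  by rewrite mulrDl; lra.
set B2 := theta * hoelder_wide + _ in Qb Qz.
have zb : E z b <= theta * (B2 * t) by apply: (engulfE CQ).
have zx2 : E z x <= theta * (B2 * t).
  apply: le_trans zx _; rewrite mulrA ler_pM2r//.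
  have : hoelder_wide <= theta * hoelder_wide by rewrite ler_peMl// ltW.
  move=> h1; have : B2 <= theta * B2 by apply: ler_peMl; [rewrite /B2; lra|exact: ltW].
  by rewrite /B2; lra.
have xb : E x b <= theta * (theta * (B2 * t)) by apply: (engulfE Cz).
have sg0 : 0 <= sg by rewrite mulr_ge0// divr_ge0 ?sqr_ge0// ltW.
have sgt : sg * (2 * max_excess) <= 2 * t.
  have r20 : 0 < rho ^+ 2 by rewrite exprn_gt0.
  apply: (@le_trans _ _ (chord_scale * t / rho ^+ 2 * (2 * max_excess))).
    apply: ler_wpM2r; first by rewrite mulr_ge0// max_excess_ge0.
    by apply: ler_piMl => //; rewrite divr_ge0// ltW.
  have := chord_scale_max (_ : 0 <= max_excess <= max_excess).
  rewrite max_excess_ge0 lexx => /(_ isT) h.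
  have -> : chord_scale * t / rho ^+ 2 * (2 * max_excess) =
    2 * t * (chord_scale * max_excess / rho ^+ 2) by field; rewrite gt_eqF.
  by apply: ler_piMr; [rewrite mulr_ge0// ltW|rewrite ler_pdivrMr// mul1r ltW].
rewrite yzE2 dotZr.
apply: (@le_trans _ _ ((l * m)^-1 * (A2 * t))).
  rewrite ler_pM2l ?invr_gt0 ?mulr_gt0// dotDr dotZr.
  have h1 := three_point n0 H Cx Cz Cb CQ.
  have h2 := three_point n0 H Cx Cz CQ Cc.
  have h3 : dot (g z - g x) (Q - c) <= 2 * max_excess.
    apply: le_trans h2 _; have := excess_le Cx CQ; have := excess_le Cz Cc; lra.
  have h4 := le_trans (ler_wpM2l sg0 h3) sgt.
  apply: le_trans (lerD (le_trans h1 (lerD xb (le_trans zQ taB))) h4) _.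
  by rewrite /A2 -/B2; lra.
apply: fin; rewrite ?invr_ge0 ?mulr_ge0 ?(ltW l0) ?(ltW m0)//; last by lra.
by apply: inv_low; [exact: ltW|rewrite m2].
Qed.

(** Prolong the segment from z to y by a factor 1 / d, beyond y or beyond z.  If
    one of the two endpoints stays in the closure of the domain, its excess is
    O(t) by [excess_growth] and [three_point] applies to it; if neither does,
    [hoelder_chord] applies to the chord. *)
Lemma excess_hoelder x y z (d t : R) : C x -> C y -> C z ->
  0 < t <= max_excess -> 0 < d <= 1 -> E x z <= t -> E z y <= d ^+ p * t ->
  E x y <= E x z + hoelder_cst * d * t.
Proof.
move=> Cx Cy Cz tT /andP[d0 d1] xz zy; have /andP[t0 _] := tT.
have th0 := theta0; have th1 := theta1.
have dp : d ^+ p <= d.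
  rewrite -(subnK (ltnW p2)) addn1 exprS; apply: ler_piMr; first exact: ltW.
  by apply: exprn_ile1 => //; exact: ltW.
have zyd : E z y <= d * t by apply: (le_trans zy); rewrite ler_pM2r.
have zyt : E z y <= t by apply: (le_trans zyd); rewrite ler_piMl// ltW.
suff : dot (g z - g x) (y - z) <= (hoelder_cst - 1) * d * t.
  move=> h; apply: (@le_trans _ _ (E x z + E z y + dot (g z - g x) (y - z))).
    by rewrite /excess; move: (g x) (g z) => gx gz; rewrite !dotE; lra.
  have -> : hoelder_cst * d * t = d * t + (hoelder_cst - 1) * d * t by ring.
  by rewrite -addrA lerD2l lerD.
have k0 := chord_scale_gt0; have c0 := hoelder_low_gt0.
have A3 := hoelder_cst_ge.
have C3 (X : R) : X <= 3 * theta ^+ 2 * t -> d * X <= (hoelder_cst - 1) * d * t.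
  move=> h; apply: (@le_trans _ _ (d * (3 * theta ^+ 2 * t))); first by rewrite ler_pM2l.
  have -> : d * (3 * theta ^+ 2 * t) = 3 * theta ^+ 2 * (d * t) by ring.
  by rewrite -[_ * d * t]mulrA ler_pM2r// mulr_gt0.
have [->|yz] := eqVneq y z.
  rewrite subrr /dot big1; last by move=> i _; rewrite !mxE mulr0.
  by have := C3 0; rewrite mulr0; apply; rewrite mulr_ge0 ?(ltW t0)// mulr_ge0// sqr_ge0.
have th2 : theta <= theta ^+ 2 by rewrite expr2 ler_peMl// ltW.
have th2t := ler_wpM2r (ltW t0) th2.
have tht : 0 < theta * t by rewrite mulr_gt0.
have zx : E z x <= theta * t.
  by apply: le_trans (excess_sym n0 H theta1 eng Cx Cz) _; rewrite ler_pM2l.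
have yz0 : E y z <= theta * (d ^+ p * t).
  by apply: le_trans (excess_sym n0 H theta1 eng Cz Cy) _; rewrite ler_pM2l.
have dV1 : 1 <= d^-1 by rewrite invf_ge1.
have dVp : d^-1 ^+ p * d ^+ p = 1 by rewrite -exprMn mulVf ?expr1n// gt_eqF.
have [Ca|Ca] := pselect (C (z + d^-1 *: (y - z))).
  have zb : E z (z + d^-1 *: (y - z)) <= 2 * theta * t.
    apply: le_trans (excess_growth n0 H theta1 eng kp Cz dV1 Ca) _.
    apply: (@le_trans _ _ (2 * d^-1 ^+ p * (d ^+ p * t))).
      by rewrite ler_pM2l// mulr_gt0// exprn_gt0// invr_gt0.
    have -> : 2 * d^-1 ^+ p * (d ^+ p * t) = 2 * t * (d^-1 ^+ p * d ^+ p) by ring.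
    by rewrite dVp mulr1 -mulrA ler_pM2l// ler_peMl// ltW.
  have zx' : E z x <= 2 * theta * t by lra.
  set b := z + _ in Ca zb.
  have xb : E x b <= theta * (2 * theta * t) by apply: (engulfE Cz).
  have -> : y - z = d *: (b - z).
    by rewrite /b; apply/rowP => i; rewrite !mxE; field; rewrite gt_eqF.
  rewrite dotZr; apply: C3.
  apply: le_trans (three_point n0 H Cx Cz Ca Cz) _; rewrite excess_xx; lra.
have {Ca}[s1 /andP[s10 s11] bP] := exit_point (dom_open H) Cy (fun h => Ca (subset_closure h)).
have [Cb|Cb] := pselect (C (y + d^-1 *: (z - y))).
  have yb : E y (y + d^-1 *: (z - y)) <= 2 * theta * t.
    apply: le_trans (excess_growth n0 H theta1 eng kp Cy dV1 Cb) _.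
    apply: (@le_trans _ _ (2 * d^-1 ^+ p * (theta * (d ^+ p * t)))).
      by rewrite ler_pM2l// mulr_gt0// exprn_gt0// invr_gt0.
    have -> : 2 * d^-1 ^+ p * (theta * (d ^+ p * t)) = 2 * theta * t * (d^-1 ^+ p * d ^+ p) by ring.
    by rewrite dVp mulr1.
  have yz' : E y z <= 2 * theta * t.
    apply: le_trans yz0 _; have : theta * (d ^+ p * t) <= theta * t.
      by rewrite ler_pM2l// ler_piMl//; lra.
    have : 0 < theta * t by rewrite mulr_gt0.
    lra.
  set b := y + _ in Cb yb.
  have zb : E z b <= theta * (2 * theta * t) by apply: (engulfE Cy).
  have zyth : E z y <= theta * t by apply: (le_trans zyt); rewrite ler_peMl// ltW.
  have xy : E x y <= theta * (theta * t) by apply: (engulfE Cz).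
  have -> : y - z = d *: (y - b).
    by rewrite /b; apply/rowP => i; rewrite !mxE; field; rewrite gt_eqF.
  rewrite dotZr; apply: C3.
  apply: le_trans (three_point n0 H Cx Cz Cy Cb) _; lra.
have {Cb}[s2 /andP[s20 s21] bQ] := exit_point (dom_open H) Cz (fun h => Cb (subset_closure h)).
have ray (s : R) (u v : 'rV[R]_n) : v + s *: (u + d^-1 *: (v - u) - v) = u + (1 + s * (d^-1 - 1)) *: (v - u).
  by rowring.
rewrite ray in bP; rewrite ray in bQ.
set r1 := 1 + _ in bP; set r2 := 1 + _ in bQ.
have r11 : 1 <= r1 by rewrite lerDl mulr_ge0//; lra.
have r21 : 1 <= r2 by rewrite lerDl mulr_ge0//; lra.
have r1d : r1 <= d^-1.
  by have := ler_piMl (_ : 0 <= d^-1 - 1) s11; rewrite subr_ge0 => /(_ dV1); rewrite /r1; lra.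
have r2d : r2 <= d^-1.
  by have := ler_piMl (_ : 0 <= d^-1 - 1) s21; rewrite subr_ge0 => /(_ dV1); rewrite /r2; lra.
have [CP _] := (bdryP (dom_open H) _).1 bP.
have [CQ _] := (bdryP (dom_open H) _).1 bQ.
have gr (r l X : R) : 1 <= r -> r <= l -> X <= theta * (d ^+ p * t) ->
    2 * r ^+ p * X <= 2 * theta * (l * d) ^+ p * t.
  move=> r1' rl hX; have r0 : 0 < r by lra.
  apply: (@le_trans _ _ (2 * r ^+ p * (theta * (d ^+ p * t)))).
    by rewrite ler_pM2l// mulr_gt0// exprn_gt0.
  have -> : 2 * theta * (l * d) ^+ p * t = 2 * l ^+ p * (theta * (d ^+ p * t)).
    by rewrite exprMn; ring.
  rewrite ler_pM2r ?mulr_gt0 ?exprn_gt0// ler_pM2l//.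
  by apply: lerXn2r => //; rewrite nnegrE; lra.
have zyth : E z y <= theta * (d ^+ p * t).
  by apply: (le_trans zy); apply: ler_peMl; rewrite ?(ltW th1)// mulr_ge0 ?exprn_ge0// ltW.
have l1 : 1 <= r1 + r2 - 1 by lra.
apply: (@hoelder_chord x y z d t (r1 + r2 - 1) _ _ Cx Cy Cz tT d0 _ xz bP bQ) => //.
- by rewrite l1/=; lra.
- by rowring.
- apply: le_trans (excess_growth n0 H theta1 eng kp Cz r11 CP) _; apply: gr => //; lra.
- apply: le_trans (excess_growth n0 H theta1 eng kp Cy r21 CQ) _; apply: gr => //; lra.
- apply: le_trans (gr 1 (r1 + r2 - 1) _ (lexx _) l1 yz0).
  rewrite expr1n mulr1; have := excess_ge0 n0 H Cy Cz; lra.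
Qed.

End Hoelder.

(** * Packing homothetic copies in a convex body *)

Section Packing.
Variables (R : realType) (n : nat).

Lemma det_norm_le (V : 'M[R]_n) (M : R) : (forall i j, `|V i j| <= M) ->
  `|\det V| <= #|'S_n|%:R * M ^+ n.
Proof.
move=> hV; rewrite /determinant; apply: le_trans (ler_norm_sum _ _ _) _.
have -> : #|'S_n|%:R * M ^+ n = \sum_(s : 'S_n) M ^+ n.
  by rewrite sumr_const -[RHS]mulr_natl.
apply: ler_sum => s _; rewrite normrM normrX normrN normr1 expr1n mul1r normr_prod.
have -> : M ^+ n = \prod_(i < n) M by rewrite prodr_const card_ord.
by apply: ler_prod => i _; rewrite normr_ge0 hV.
Qed.

Lemma cramer_row (V : 'M[R]_n) (w : 'rV[R]_n) i : V \in unitmx ->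
  (w *m invmx V) ord0 i =
  \det (\matrix_(k, j) if k == i then w ord0 j else V k j) / \det V.
Proof.
move=> uV; set W := \matrix_(_, _) _.
rewrite /invmx uV -scalemxAr !mxE mulrC; congr (_ / _).
rewrite (expand_det_row W i); apply: eq_bigr => j _.
rewrite !mxE eqxx; congr (_ * _); rewrite /cofactor; congr (_ * \det _).
by apply/matrixP => k l; rewrite !mxE eq_sym (negbTE (neq_lift _ _)).
Qed.

Variable B : set 'rV[R]_n.

(** Among the simplices with vertices in B take one whose determinant is at least
    half of the supremum.  By Cramer's rule, coordinates in this frame are
    ratios of two such determinants, hence bounded by 2 on B.  This is an
    affine normalization of B. *)
Lemma frame (M : R) c (d : R) : (forall b i, B b -> `|b ord0 i| <= M) ->
  0 < d -> B c -> (forall i, B (c + d *: delta_mx ord0 i)) ->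
  exists b0 (V : 'M[R]_n), [/\ V \in unitmx, B b0, forall i, B (b0 + row i V) &
    forall b i, B b -> `|((b - b0) *m invmx V) ord0 i| <= 2].
Proof.
move=> bM d0 Bc Bcd.
pose S : set R := [set r | exists b0 (V : 'M[R]_n), [/\ B b0, forall i, B (b0 + row i V) & r = `|\det V|]].
have Sd : S (d ^+ n).
  exists c, (d%:M); split=> //; last by rewrite det_scalar ger0_norm// exprn_ge0// ltW.
  move=> i; have -> // : row i d%:M = d *: delta_mx ord0 i.
  by apply/rowP => j; rewrite !mxE eqxx/= [j == i]eq_sym mulr_natr.
have Sb : ubound S (#|'S_n|%:R * (2 * M) ^+ n).
  move=> r [b0 [V [Bb0 BV ->]]]; apply: det_norm_le => i j.
  have -> : V i j = (b0 + row i V) ord0 j - b0 ord0 j by rewrite !mxE; ring.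
  apply: le_trans (ler_normB _ _) _.
  by have := bM _ j (BV i); have := bM _ j Bb0; lra.
have Shs : has_sup S by split; [exists (d ^+ n)|eexists; exact: Sb].
have s0 : 0 < sup S.
  by apply: (@lt_le_trans _ _ (d ^+ n)); [rewrite exprn_gt0|apply: ub_le_sup => //; eexists; exact: Sb].
have s20 : 0 < sup S / 2 by rewrite divr_gt0.
have [r [b0 [V [Bb0 BV rE]]] hr] := sup_adherent s20 Shs.
have r0 : 0 < r by lra.
have uV : V \in unitmx by rewrite unitmxE unitfE -normr_gt0 -rE.
exists b0, V; split=> // b i Bb.
rewrite cramer_row// normrM normfV -rE ler_pdivrMr//.
set W := \matrix_(_, _) _.
have : S `|\det W|.
  exists b0, W; split=> // k; have [->|ki] := eqVneq k i.
    by have -> : b0 + row i W = b by apply/rowP => j; rewrite !mxE eqxx; ring.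
  have -> : row k W = row k V by apply/rowP => j; rewrite !mxE (negbTE ki).
  exact: BV.
move/(ub_le_sup (ex_intro _ _ Sb)); lra.
Qed.

Hypothesis segB : forall a b (s : R), B a -> B b -> 0 <= s <= 1 -> B (a + s *: (b - a)).

(** The point is the mean of the n points b0 + (n a_i) v_i, each on an edge of the
    simplex. *)
Lemma frame_cube b0 (V : 'M[R]_n) (a : 'rV[R]_n) : (0 < n)%N ->
  B b0 -> (forall i, B (b0 + row i V)) ->
  (forall i, 0 <= a ord0 i <= n%:R^-1) -> B (b0 + a *m V).
Proof.
move=> n0 Bb0 BV ha; have n0' : (0 : R) < n%:R by rewrite ltr0n.
pose x (i : 'I_n) := b0 + (n%:R * a ord0 i) *: (b0 + row i V - b0).
have Bx i : B (x i).
  apply: segB => //; have /andP[h0 h1] := ha i.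
  by rewrite mulr_ge0 ?ler0n//= mulrC -ler_pdivlMr// mul1r.
have [] := jensen_mean (f := fun _ => 0) segB _ n0 Bx.
  by move=> *; rewrite subrr mulr0 addr0.
move=> + _; congr B; rewrite /x big_split/= sumr_const card_ord.
rewrite -[b0 *+ n]scaler_nat scalerDr scalerA mulVf ?gt_eqF// scale1r; congr (_ + _).
apply/rowP => j; rewrite !mxE summxE.
rewrite mulr_sumr; apply: eq_bigr => i _; rewrite !mxE; field.
by rewrite gt_eqF.
Qed.
End Packing.

(** A bounded convex set with nonempty interior contains at most N points whose
    homothetic copies of the set, of ratio s, are pairwise disjoint. *)
Definition packing_bound (R : realType) (n : nat) (s : R) (N : nat) : Prop :=
  forall (B : set 'rV[R]_n) (M : R) c (d : R) (x : nat -> 'rV[R]_n) (J : seq nat),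
  (forall a b (r : R), B a -> B b -> 0 <= r <= 1 -> B (a + r *: (b - a))) ->
  (forall b i, B b -> `|b ord0 i| <= M) ->
  0 < d -> B c -> (forall i, B (c + d *: delta_mx ord0 i)) ->
  uniq J -> (forall j, j \in J -> B (x j)) ->
  (forall j k b b', j \in J -> k \in J -> j != k -> B b -> B b' ->
     x j + s *: (b - x j) <> x k + s *: (b' - x k)) ->
  (size J <= N)%N.

(** In normalized coordinates the set lies in a cube of side 4, which is cut into
    cells of side s / n.  If x_j and x_k lie in the same cell, then
    ((1 - s) / s) (x_j - x_k) has coordinates at most 1 / n, hence is the
    difference b' - b of two points of the simplex, namely those given by its
    positive and negative parts; then the homothetic copies share a point. *)
Lemma packing (R : realType) (n : nat) (s : R) : (0 < n)%N -> 0 < s <= 1 ->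
  exists N : nat, packing_bound n s N.
Proof.
move=> n0 /andP[s0 s1]; have n0' : (0 : R) < n%:R by rewrite ltr0n.
pose e : R := s / n%:R; have e0 : 0 < e by rewrite divr_gt0.
pose N0 := Num.truncn (4 / e).
exists #|{ffun 'I_n -> 'I_N0.+1}|.
move=> B M c d x J segB bM d0 Bc Bcd uJ BJ dis.
have [b0 [V [uV Bb0 BV hV]]] := frame bM d0 Bc Bcd.
pose co j : 'rV[R]_n := (x j - b0) *m invmx V.
pose f j : {ffun 'I_n -> 'I_N0.+1} := [ffun i => inord (Num.truncn ((co j ord0 i + 2) / e))].
have cop j i : j \in J -> 0 <= (co j ord0 i + 2) / e <= 4 / e.
  move=> jJ; have := hV _ i (BJ _ jJ); rewrite -/(co j) ler_norml => /andP[h1 h2].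
  by rewrite divr_ge0 ?(ltW e0)//= ?ler_pM2r ?invr_gt0//; lra.
have finj : {in J &, injective f}.
  move=> j k jJ kJ fE; apply/eqP; apply: contraT => jk; exfalso.
  have close i : `|(co j - co k) ord0 i| <= e.
    have := congr1 (fun h : {ffun 'I_n -> 'I_N0.+1} => val (h i)) fE.
    rewrite !ffunE.
    have inordE l : l \in J -> val (inord (Num.truncn ((co l ord0 i + 2) / e)) : 'I_N0.+1) = Num.truncn ((co l ord0 i + 2) / e).
      move=> lJ; rewrite /= inordK// ltnS; have /andP[_ h] := cop l i lJ.
      exact: le_truncn.
    rewrite !inordE// => tE.
    have /andP[j1 j2] := truncn_itv (andP (cop j i jJ)).1.
    have /andP[k1 k2] := truncn_itv (andP (cop k i kJ)).1.
    rewrite tE in j1 j2; rewrite -natr1 in j2; rewrite -natr1 in k2.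
    have -> : (co j - co k) ord0 i = co j ord0 i - co k ord0 i by rewrite mxE; congr (_ + _); rewrite mxE.
    rewrite ler_pdivlMr// in j1; rewrite ler_pdivlMr// in k1.
    rewrite ltr_pdivrMr// in j2; rewrite ltr_pdivrMr// in k2.
    rewrite ler_norml; move: j1 j2 k1 k2.
    move: ((Num.truncn ((co k ord0 i + 2) / e))%:R : R) (co j ord0 i) (co k ord0 i) => q X Y. lra.
  pose ga := ((1 - s) / s) *: (co j - co k).
  have gale i : `|ga ord0 i| <= n%:R^-1.
    rewrite mxE normrM ger0_norm; last by rewrite divr_ge0 ?subr_ge0// ltW.
    apply: (@le_trans _ _ ((1 - s) / s * e)).
      by rewrite ler_wpM2l// divr_ge0 ?subr_ge0// ltW.
    rewrite /e (_ : _ / s * _ = (1 - s) * n%:R^-1); last by field; rewrite !gt_eqF.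
    by apply: ler_piMl; [rewrite invr_ge0 ltW|lra].
  pose gp : 'rV[R]_n := \row_i Num.max (ga ord0 i) 0.
  pose gm : 'rV[R]_n := \row_i Num.max (- ga ord0 i) 0.
  have hp : B (b0 + gp *m V).
    apply: frame_cube => // i; rewrite mxE le_max lexx orbT/= ge_max invr_ge0 ler0n andbT.
    by apply: le_trans (gale i); exact: ler_norm.
  have hm : B (b0 + gm *m V).
    apply: frame_cube => // i; rewrite mxE le_max lexx orbT/= ge_max invr_ge0 ler0n andbT.
    by apply: le_trans (gale i); rewrite -normrN; exact: ler_norm.
  apply: (dis j k _ _ jJ kJ jk hm hp).
  have gE : gp = ga + gm.
    have posneg (a : R) : Num.max a 0 = a + Num.max (- a) 0.
      have [h|h] := lerP 0 a; first by rewrite max_r ?addr0// oppr_le0.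
      by rewrite max_l ?subrr// oppr_ge0 ltW.
    by apply/rowP => i; rewrite mxE posneg [RHS]mxE; congr (_ + _); rewrite [RHS]mxE.
  have gaV : s *: (ga *m V) = (1 - s) *: (x j - x k).
    rewrite -scalemxAl scalerA /co -mulmxBl -mulmxA mulVmx// mulmx1.
    rewrite mulrCA divff ?gt_eqF// mulr1; congr (_ *: _); rowring.
  rewrite gE mulmxDl; move: (ga *m V) (gm *m V) gaV => u w uE.
  have -> : x k + s *: (b0 + (u + w) - x k) = s *: u + (x k + s *: (b0 + w - x k)).
    rowring.
  rewrite uE; rowring.
have : uniq (map f J) by rewrite map_inj_in_uniq.
move/card_uniqP; rewrite size_map => <-; exact: max_card.
Qed.

(** * Greedy selection *)

(** Remove from A, repeatedly, the set S x attached to a point x whose t x is at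
    least half of the supremum of t over what is left.  A point that is never
    removed stays in competition at every step. *)
Lemma greedy_selection (R : realType) (n : nat) (A : set 'rV[R]_n)
    (t : 'rV[R]_n -> R) (S : 'rV[R]_n -> set 'rV[R]_n) (M : R) :
  (forall x, A x -> 0 < t x <= M) ->
  exists (D : set nat) (x : nat -> 'rV[R]_n),
    [/\ initial_segment D, forall k, D k -> A (x k),
        forall j k, (j < k)%N -> D k -> ~ S (x j) (x k),
        forall j k, (j <= k)%N -> D k -> t (x k) <= 2 * t (x j) &
        forall y, A y -> (forall k, D k -> ~ S (x k) y) ->
          forall k, D k /\ t y <= 2 * t (x k)].
Proof.
move=> tM.
have pickP (B : set 'rV[R]_n) : exists x, B `<=` A -> B !=set0 ->
    B x /\ forall y, B y -> t y <= 2 * t x.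
  have [[BA [b Bb]]|nB] := pselect (B `<=` A /\ B !=set0); last first.
    by exists 0 => BA B0; case: nB.
  pose T : set R := [set t y | y in B].
  have Tub : ubound T M by move=> _ [y By <-]; have /andP[] := tM _ (BA _ By).
  have Ts : has_sup T by split; [exists (t b), b|exists M].
  have tb : t b <= sup T by apply: ub_le_sup; [exists M|exists b].
  have /andP[tb0 _] := tM _ (BA _ Bb).
  have s0 : 0 < sup T / 2 by rewrite divr_gt0//; exact: lt_le_trans tb.
  have [_ [x Bx <-] hx] := sup_adherent s0 Ts.
  exists x => _ _; split=> // y By.
  have : t y <= sup T by apply: ub_le_sup; [exists M|exists y].
  lra.
have [pick hpick] := choice pickP.
pose Rm := fix Rm k := if k is k'.+1 then Rm k' `\` S (pick (Rm k')) else A.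
have RmS k : Rm k.+1 = Rm k `\` S (pick (Rm k)) by [].
have Rdec j k : (j <= k)%N -> Rm k `<=` Rm j.
  move=> jk; rewrite -(subnK jk); elim: (k - j)%N => [|m IH]; first by [].
  by rewrite addSn => y [/IH].
have RA k : Rm k `<=` A by exact: (Rdec 0%N).
exists [set k | Rm k !=set0], (fun k => pick (Rm k)); split.
- by move=> j k jk [y Ry]; exists y; exact: Rdec jk _ Ry.
- by move=> k Rk; apply: (RA k); have [] := hpick _ (RA k) Rk.
- move=> j k jk Rk; have [Rx _] := hpick _ (RA k) Rk.
  by have := Rdec _ _ jk _ Rx; rewrite RmS => -[].
- move=> j k jk Rk; have [Rx _] := hpick _ (RA k) Rk.
  have Rjx := Rdec _ _ jk _ Rx.
  by have [_ ->] := hpick _ (RA j) (ex_intro _ _ Rjx).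
- move=> y Ay ny.
  have Ry k : Rm k y.
    elim: k => [//|k IH]; rewrite RmS; split=> //; apply: ny; by exists y.
  by move=> k; split; [exists y|have [_ ->] := hpick _ (RA k) (ex_intro _ _ (Ry k))].
Qed.

Section Selection.
Variables (R : realType) (n : nat) (rho theta : R) (p : nat).
Hypothesis n0 : (0 < n)%N.
Hypothesis rho0 : 0 < rho.
Hypothesis theta1 : 1 < theta.
Hypothesis p2 : (2 <= p)%N.
Hypothesis kp : 2 * doubling_ratio theta ^+ p <= 1.
Variables (lambda Lambda : R) (Omega : set 'rV[R]_n) (phi : 'rV[R]_n -> R^o).
Hypothesis H : structural rho lambda Lambda Omega phi.
Hypothesis eng : engulfs theta Omega phi.
Local Notation C := (closure Omega).
Local Notation E := (excess Omega phi).
Local Notation T0 := (max_excess n rho theta).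
Local Notation alpha := (2 * theta ^+ 2).
Local Notation engulfE := (engulf n0 H theta1 eng).
Let theta0 : 0 < theta. Proof. exact: lt_trans theta1. Qed.

Variables (D : set nat) (x : nat -> 'rV[R]_n) (t : nat -> R).
Hypothesis Cx : forall k, D k -> C (x k).
Hypothesis t0 : forall k, D k -> 0 < t k.
Hypothesis Dini : initial_segment D.
Hypothesis xsep : forall j k, (j < k)%N -> D k -> ~ msection Omega phi (x j) (t j) (x k).
Hypothesis tdec : forall j k, (j <= k)%N -> D k -> t k <= 2 * t j.

(** If z were common, then with u = 2 t_j / alpha >= t_k / alpha both centres
    would be at excess < theta u from z, so x_k would be at excess
    < theta^2 u = t_j from x_j. *)
Lemma selected_disjoint_lt j k z : (j < k)%N -> D k ->
  msection Omega phi (x j) (t j / alpha) z ->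
  msection Omega phi (x k) (t k / alpha) z -> False.
Proof.
move=> jk Dk /msectionE[Cz jz] /msectionE[_ kz].
have Dj : D j by apply: Dini Dk; exact: ltnW.
have th0 := theta0; have a0 : 0 < alpha by rewrite mulr_gt0// exprn_gt0.
have tj := t0 Dj; have tk := t0 Dk; have tjk := tdec (ltnW jk) Dk.
pose u := 2 * (t j / alpha).
have tja : 0 < t j / alpha by rewrite divr_gt0.
have u0 : 0 < u by rewrite mulr_gt0.
have jz' : E (x j) z < u by rewrite /u; lra.
have kz' : E (x k) z < u.
  by apply: lt_le_trans kz _; rewrite /u mulrA ler_pM2r ?invr_gt0.
have zk : E z (x k) < theta * u.
  by apply: (engulf_lt n0 H eng (Cx Dk)) => //; [exact: Cx|rewrite excess_xx].
have zj : E z (x j) < theta * u.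
  by apply: (engulf_lt n0 H eng (Cx Dj)) => //; [exact: Cx|rewrite excess_xx].
apply: (xsep jk Dk); apply/msectionE; split; first exact: Cx.
have -> : t j = theta * (theta * u) by rewrite /u; field; rewrite gt_eqF.
by apply: (engulf_lt n0 H eng Cz) => //; exact: Cx.
Qed.

Lemma selected_disjoint : trivIset D (fun k => msection Omega phi (x k) (t k / alpha)).
Proof.
move=> j k Dj Dk [z [jz kz]]; apply/eqP; case: (ltngtP j k) => // jk.
- by case: (selected_disjoint_lt jk Dk jz kz).
- by case: (selected_disjoint_lt jk Dj kz jz).
Qed.

Lemma ball_in_closure : exists c (d : R), [/\ 0 < d, C c & forall i, C (c + d *: delta_mx ord0 i)].
Proof.
have [c Oc] := dom_nonempty H.
have [e e0 he] := open_norm_ball (dom_open H) Oc.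
exists c, (e / 2); split; [by rewrite divr_gt0|exact: subset_closure|move=> i].
apply/subset_closure/he; rewrite addrC addKr normrZ gtr0_norm ?divr_gt0//.
have := delta_norm_le R i; have : 0 < e / 2 by rewrite divr_gt0.
have : e / 2 < e by rewrite ltr_pdivrMr//; lra.
move: (e / 2) (`|_|) => u v ue u0 v1; apply: le_lt_trans ue; by apply: ler_piMr => //; exact: ltW.
Qed.

(** Homothety about x_j multiplies the excess from x_j by at most s, so these
    points lie in the disjoint sections. *)
Lemma shrunk_disjoint (s : R) j k b b' : 0 <= s <= 1 ->
  D j -> D k -> j != k -> C b -> C b' ->
  s * E (x j) b < t j / alpha -> s * E (x k) b' < t k / alpha ->
  x j + s *: (b - x j) <> x k + s *: (b' - x k).
Proof.
move=> s01 Dj Dk jk Cb Cb' hj hk eq; move/eqP: jk; apply.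
have Cj := Cx Dj; have Ck := Cx Dk.
apply: selected_disjoint => //; exists (x j + s *: (b - x j)); split.
  apply/msectionE; split; first exact: (domain_segment H).
  by apply: le_lt_trans hj; exact: (excess_ray H).
rewrite eq; apply/msectionE; split; first exact: (domain_segment H).
by apply: le_lt_trans hk; exact: (excess_ray H).
Qed.

(** Homothetic copies of the whole domain, of ratio proportional to ta, would fit in
    the disjoint sections around infinitely many points. *)
Lemma heights_not_bounded_away (ta : R) : 0 < ta ->
  (forall k, D k /\ ta <= t k) -> False.
Proof.
move=> ta0 h; have th0 := theta0.
have a0 : 0 < alpha by rewrite mulr_gt0// exprn_gt0.
have TT : 0 <= T0 by exact: max_excess_ge0.
pose q := ta / alpha / (T0 + 1).
have T1 : 0 < T0 + 1 by rewrite ltr_pwDr.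
have q0 : 0 < q by rewrite !divr_gt0.
pose s := Num.min 1 q.
have s01 : 0 < s <= 1 by rewrite lt_min ltr01 q0 ge_min lexx.
have s01' : 0 <= s <= 1 by case/andP: s01 => /ltW -> ->.
have [N hN] := packing n0 s01.
have [c [d [d0 Cc Cd]]] := ball_in_closure.
suff : (size (iota 0 N.+1) <= N)%N by rewrite size_iota ltnn.
apply: (hN C rho^-1 c d x) => //.
- by move=> a b r; exact: (domain_segment H).
- by move=> b i; exact: (closure_entry H).
- exact: iota_uniq.
- by move=> j _; apply: Cx; have [] := h j.
- move=> j k b b' _ _ jk Cb Cb'.
  suff small l a : C a -> s * E (x l) a < t l / alpha.
    by have [Dj _] := h j; have [Dk _] := h k; apply: shrunk_disjoint => //; exact: small.
  move=> Ca; have [Dl tl] := h l.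
  apply: (@lt_le_trans _ _ (ta / alpha)); last by rewrite ler_pM2r ?invr_gt0.
  apply: (@le_lt_trans _ _ (q * T0)); last first.
    by rewrite /q mulrAC ltr_pdivrMr// ltr_pM2l ?divr_gt0// ltrDl.
  apply: ler_pM.
  + by case/andP: s01'.
  + exact: (excess_ge0 n0 H (Cx Dl) Ca).
  + by rewrite ge_min lexx orbT.
  + exact: (excess_le n0 rho0 theta1 H eng (Cx Dl) Ca).
Qed.

(** The homothety ratio that fits the common section B of [generation_count],
    of height 3 theta ta, into a section of height t_j / alpha around x_j:
    B has excess at most 3 theta^2 t_j from x_j, and 3 / 8 < 1 / 2. *)
Definition gen_ratio : R := (8 * theta ^+ 4)^-1.

Lemma gen_ratio01 : 0 < gen_ratio <= 1.
Proof.
have th0 := theta0; have th4 : 0 < theta ^+ 4 by rewrite exprn_gt0.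
have th41 : 1 <= theta ^+ 4 by rewrite exprn_ege1// ltW.
by rewrite /gen_ratio invr_gt0 invf_le1 mulr_gt0//=; lra.
Qed.

(** Packing in the section B of z with height 3 theta ta, which contains the
    centres x_j by engulfing.  Boundary points z are allowed: B contains the
    homothetic copy about z of a simplex in the domain. *)
Lemma generation_count (N : nat) : packing_bound n gen_ratio N ->
  forall z (ta : R) (J : seq nat), C z -> 0 < ta -> uniq J ->
  (forall j, j \in J -> [/\ D j, E (x j) z <= t j & ta <= t j <= 2 * ta]) ->
  (size J <= N)%N.
Proof.
move=> hN z ta J Cz ta0 uJ hJ.
have th0 := theta0; have th1 := theta1.
have TT : 0 <= T0 by exact: max_excess_ge0.
have [c [d [d0 Cc Cd]]] := ball_in_closure.
pose h := 3 * theta * ta.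
have h0 : 0 < h by rewrite !mulr_gt0.
pose B : set 'rV[R]_n := [set b | C b /\ E z b < h].
pose s := Num.min 1 (h / (T0 + 1)).
have T1 : 0 < T0 + 1 by rewrite ltr_pwDr.
have s0 : 0 < s by rewrite lt_min ltr01 divr_gt0.
have s1 : s <= 1 by rewrite ge_min lexx.
have s01 : 0 <= s <= 1 by rewrite s1 ltW.
have Bs b : C b -> B (z + s *: (b - z)).
  move=> Cb; split; first exact: (domain_segment H).
  apply: le_lt_trans (excess_ray H Cz Cb s01) _.
  apply: (@le_lt_trans _ _ (h / (T0 + 1) * T0)).
    apply: ler_pM; [exact: ltW|exact: (excess_ge0 n0 H)|by rewrite ge_min lexx orbT|].
    exact: (excess_le n0 rho0 theta1 H eng).
  by rewrite mulrAC ltr_pdivrMr// ltr_pM2l// ltrDl.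
apply: (hN B rho^-1 (z + s *: (c - z)) (s * d) x) => //.
- move=> a b r [Ca Ea] [Cb Eb] r01; split; first exact: (domain_segment H).
  apply: le_lt_trans (excess_segment H z Ca Cb r01) _.
  move: (E z a) (E z b) Ea Eb r01 => u v ua vb /andP[r0 r1].
  have [->|rn] := eqVneq r 0; first by rewrite mul0r addr0.
  have rp : 0 < r by rewrite lt_neqAle eq_sym rn.
  have : 0 < r * (h - v) by rewrite mulr_gt0// subr_gt0.
  have : 0 <= (1 - r) * (h - u) by rewrite mulr_ge0 ?subr_ge0// ltW.
  lra.
- by move=> b i [Cb _]; exact: (closure_entry H).
- by rewrite mulr_gt0.
- exact: Bs.
- move=> i; have := Bs _ (Cd i); congr B; rowring.
- move=> j jJ; have [Dj jz /andP[tj1 tj2]] := hJ j jJ; split; first exact: Cx.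
  apply: (@le_lt_trans _ _ (theta * t j)).
    by apply: (engulfE (Cx Dj)) => //; [exact: Cx|rewrite excess_xx ltW ?t0].
  have : theta * t j <= theta * (2 * ta) by rewrite ler_pM2l.
  have : 0 < theta * ta by rewrite mulr_gt0.
  rewrite /h; lra.
move=> j k b b' jJ kJ jk Bb Bb'.
have [Dj _ _] := hJ j jJ; have [Dk _ _] := hJ k kJ.
have /andP[g0 g1] := gen_ratio01.
have key l a : l \in J -> B a -> gen_ratio * E (x l) a < t l / alpha.
  move=> lJ [Ca Ea]; have [Dl lz /andP[tl1 tl2]] := hJ l lJ.
  have tl0 := t0 Dl.
  have zl : E z (x l) <= theta * t l.
    by apply: (engulfE (Cx Dl)) => //; [exact: Cx|rewrite excess_xx ltW].
  have hl : h <= 3 * theta * t l by rewrite /h ler_pM2l// mulr_gt0.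
  have tht : 0 < theta * t l by rewrite mulr_gt0.
  have la : E (x l) a <= theta * (3 * theta * t l).
    by apply: (engulfE Cz) => //; [exact: Cx|lra|lra].
  apply: (@le_lt_trans _ _ (gen_ratio * (theta * (3 * theta * t l)))).
    by rewrite ler_pM2l.
  have -> : gen_ratio * (theta * (3 * theta * t l)) = 3 / 4 * (t l / alpha).
    by rewrite /gen_ratio; field; rewrite gt_eqF.
  have : 0 < t l / alpha by rewrite divr_gt0// mulr_gt0// exprn_gt0.
  lra.
have g01 : 0 <= gen_ratio <= 1 by rewrite g1 ltW.
have [Cb _] := Bb; have [Cb' _] := Bb'.
by apply: shrunk_disjoint => //; exact: key.
Qed.

Local Notation Ac := (hoelder_cst n rho theta p).

(** Otherwise x_j would be so close to z that [excess_hoelder], applied with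
    C d = eps, would put it in the section of x_i, which it avoids. *)
Lemma later_height_lower i j z (eps : R) : (i < j)%N -> D j -> 0 < eps < 1 -> C z ->
  E (x i) z < (1 - eps) * t i -> E (x j) z < t j ->
  (eps / (Ac + 1)) ^+ p * t i <= theta * t j.
Proof.
move=> ij Dj /andP[e0 e1] Cz iz jz.
have th0 := theta0; have Di : D i by apply: Dini Dj; exact: ltnW.
have ti := t0 Di; have tj := t0 Dj.
rewrite leNgt; apply/negP => lt.
have A1 : 0 < Ac.
  have := hoelder_cst_ge n p rho0 theta1; have : 0 <= theta ^+ 2 by exact: sqr_ge0.
  lra.
have Cxi := Cx Di; have Cxj := Cx Dj.
have far : t i <= E (x i) (x j).
  by rewrite leNgt; apply/negP => h; apply: (xsep ij Dj); apply/msectionE.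
have tT : t i <= T0 by apply: (le_trans far); exact: (excess_le n0 rho0 theta1 H eng).
have zj : E z (x j) <= theta * t j.
  by apply: (engulfE Cxj) => //; [exact: ltW|rewrite excess_xx ltW].
pose d := eps / (Ac + 1).
have d0 : 0 < d by rewrite divr_gt0//; lra.
have dA : d * (Ac + 1) = eps by rewrite divfK// gt_eqF//; lra.
have d1 : d <= 1 by rewrite ler_pdivrMr; lra.
have hz : E (x i) z <= t i.
  by apply/ltW/(lt_le_trans iz); apply: ler_piMl; [exact: ltW|lra].
have dd : 0 < d <= 1 by rewrite d0.
have tt : 0 < t i <= T0 by rewrite ti.
have := excess_hoelder n0 rho0 theta1 p2 kp H eng Cxi Cxj Cz tt dd hz (le_trans zj (ltW lt)).
have : Ac * d * t i <= eps * t i.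
  by rewrite ler_pM2r// -dA mulrC ler_pM2l//; lra.
lra.
Qed.

End Selection.

(** * Counting and conclusion *)

(** Generation k consists of the indices with height in (T / 2^k, 2 T / 2^k]. *)
Lemma dyadic_count (R : realType) (N : nat) (T a : R) (t : nat -> R) (J : seq nat) :
  0 < T -> 2 <= a -> (forall j, j \in J -> 2 * T / a <= t j <= 2 * T) ->
  (forall (ta : R) (J' : seq nat), 0 < ta -> subseq J' J ->
     (forall j, j \in J' -> ta <= t j <= 2 * ta) -> (size J' <= N)%N) ->
  (size J)%:R <= N%:R * (ln a / ln 2 + 1).
Proof.
move=> T0 a2 hJ hN.
have l2 : 0 < ln 2 :> R by rewrite ln_gt0// ltr1n.
have a0 : 0 < a by lra.
pose m j := Num.truncn (ln (2 * T / t j) / ln 2).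
pose G := Num.truncn (ln a / ln 2).
have tj0 j : j \in J -> 0 < t j.
  by move=> /hJ/andP[h _]; apply: lt_le_trans h; rewrite divr_gt0// mulr_gt0.
have mG j : j \in J -> (m j <= G)%N.
  move=> jJ; apply: le_truncn; rewrite ler_pM2r ?invr_gt0//.
  have tj := tj0 _ jJ; have /andP[h1 h2] := hJ _ jJ.
  rewrite ler_ln ?posrE ?divr_gt0 ?mulr_gt0//.
  by rewrite ler_pdivrMr// [a * _]mulrC -ler_pdivrMr.
have gen (k : nat) : (count (fun j => m j == k) J <= N)%N.
  rewrite -size_filter; apply: (hN (T / 2 ^+ k)); first by rewrite divr_gt0// exprn_gt0.
    exact: filter_subseq.
  move=> j; rewrite mem_filter => /andP[/eqP mk jJ].
  have tj := tj0 _ jJ; have /andP[h1 h2] := hJ _ jJ.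
  have q1 : 1 <= 2 * T / t j by rewrite ler_pdivlMr// mul1r.
  have q0 : 0 < 2 * T / t j by lra.
  have lq : 0 <= ln (2 * T / t j) / ln 2 by rewrite divr_ge0 ?(ltW l2)// ln_ge0.
  have := truncn_itv lq; rewrite -/(m j) mk ler_pdivlMr// ltr_pdivrMr//.
  have p0 i : 0 < (2 : R) ^+ i by rewrite exprn_gt0.
  have lnp i : i%:R * ln 2 = ln ((2 : R) ^+ i) by rewrite lnXn// mulr_natl.
  rewrite !lnp ler_ln ?posrE// ltr_ln ?posrE// => /andP[k1 k2].
  move: k1; rewrite ler_pdivlMr// => k1; move: k2; rewrite ltr_pdivrMr// exprS => k2.
  rewrite ler_pdivrMr// mulrA ler_pdivlMr//; apply/andP; split; lra.
have cnt : (size J <= N * G.+1)%N.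
  have -> : size J = (\sum_(k < G.+1) count (fun j => m j == k) J)%N.
    rewrite -sum1_size (partition_big (fun j => inord (m j) : 'I_G.+1) predT)//=.
    apply: eq_bigr => k _; rewrite -sum1_count big_seq_cond [RHS]big_seq_cond.
    apply: eq_bigl => j; case: (boolP (j \in J)) => //= jJ.
    by rewrite -val_eqE/= inordK// ltnS mG.
  apply: (@leq_trans (\sum_(k < G.+1) N)); first by apply: leq_sum => k _; exact: gen.
  by rewrite sum_nat_const card_ord mulnC.
have : (size J)%:R <= (N * G.+1)%:R :> R by rewrite ler_nat.
move=> h; apply: le_trans h _; rewrite natrM ler_wpM2l// -natr1 lerD2r.
by rewrite truncn_le divr_ge0 ?(ltW l2)// ln_ge0//; lra.
Qed.

Lemma esum_indic_le (R : realType) (T : Type) (D : set nat) (S : nat -> set T) z (K : R) :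
  (forall J : seq nat, uniq J -> (forall j, j \in J -> D j /\ S j z) -> (size J)%:R <= K) ->
  (\esum_(k in D) (\1_(S k) z)%:E <= K%:E)%E.
Proof.
move=> hK; apply: ge_ereal_sup => _ [F [finF FD] <-].
rewrite fsbig_finite//= sumEFin lee_fin.
pose J := [seq k <- finmap.enum_fset (fset_set F) | `[< S k z >]].
apply: le_trans (hK J _ _).
- rewrite /J size_filter -sum1_count natr_sum [leRHS]big_mkcond/=.
  by apply: ler_sum => k _; rewrite indicE -[z \in S k]/(`[< S k z >]); case: ifP.
- by rewrite filter_uniq// finmap.fset_uniq.
- move=> j; rewrite mem_filter => /andP[/asboolP Sj]; rewrite in_fset_set// inE => Fj.
  by split=> //; exact: FD.
Qed.

Lemma exists_growth_exponent (R : realType) (k : R) : 0 <= k < 1 ->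
  exists2 p, (2 <= p)%N & 2 * k ^+ p <= 1.
Proof.
move=> /andP[k0 k1]; have nk : `|k| < 1 by rewrite ger0_norm.
have /cvgrPdist_lt /(_ 2^-1) := cvg_expr nk.
rewrite invr_gt0 ltr0n => /(_ isT) [m _ hm].
exists (maxn 2 m); first exact: leq_maxl.
have := hm (maxn 2 m) (leq_maxr _ _).
rewrite /= sub0r normrN ger0_norm ?exprn_ge0// => h.
by rewrite -ler_pdivlMl// mulr1 ltW.
Qed.

(* The factor max(1, log(1/eps)) is log(1/eps) for eps <= 1/e.  A bound
   K log(1/eps) uniform up to eps = 1 is false for nonempty A: its right-hand
   side tends to 0 as eps -> 1, while the sum is >= 1 at each centre x_k. *)
Theorem lemma2p5 (R : realType) (n : nat) (rho lambda Lambda theta : R)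
    (hn : (0 < n)%N) (hrho : 0 < rho) (hlambda : 0 < lambda)
    (hLambda : 0 < Lambda)
    (htheta : @engulfing_constant R n rho lambda Lambda theta) :
  exists K : R, 0 < K /\
  forall (Omega : set 'rV[R]_n) (phi : 'rV[R]_n -> R^o),
    structural rho lambda Lambda Omega phi ->
  forall (A : set 'rV[R]_n) (t : 'rV[R]_n -> R) (M : R),
    A `<=` closure Omega ->
    (forall x, A x -> 0 < t x <= M) ->
  exists (D : set nat) (x : nat -> 'rV[R]_n),
    [/\ initial_segment D,
        forall k, D k -> A (x k)
      & [/\ A `<=` \bigcup_(k in D) msection Omega phi (x k) (t (x k)),
            forall k, D k ->
              ~ (\bigcup_(j in `I_k) msection Omega phi (x j) (t (x j))) (x k),
            trivIset D (fun k =>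
              msection Omega phi (x k) (t (x k) / (2 * theta ^+ 2)))
          & forall (eps : R) (z : 'rV[R]_n), 0 < eps < 1 ->
              (\esum_(k in D)
                 (\1_(msection Omega phi (x k) ((1 - eps) * t (x k))) z)%:E
               <= (K * Num.max 1 (ln (eps^-1)))%:E)%E]].
Proof.
have [th1 heng] := htheta.
have th0 : 0 < theta := lt_trans ltr01 th1.
have [p p2 kp] : exists2 p, (2 <= p)%N & 2 * doubling_ratio theta ^+ p <= 1.
  apply: exists_growth_exponent; rewrite /doubling_ratio.
  have i0 : 0 < (2 * (1 + theta))^-1 by rewrite invr_gt0; lra.
  have i1 : (2 * (1 + theta))^-1 <= 1 by rewrite invf_le1; lra.
  by apply/andP; split; lra.
have [N hN] := packing (R := R) hn (gen_ratio01 th1).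
pose Ac := hoelder_cst n rho theta p.
have A1 : 0 < Ac.
  have := hoelder_cst_ge n p hrho th1; have : 0 <= theta ^+ 2 by exact: sqr_ge0.
  rewrite /Ac; lra.
have l2 : 0 < ln 2 :> R by rewrite ln_gt0// ltr1n.
have lth : 0 <= ln theta by rewrite ln_ge0// ltW.
have lA : 0 <= ln (Ac + 1) by rewrite ln_ge0//; lra.
pose K0 := (ln 2 + ln theta + p%:R * ln (Ac + 1) + p%:R) / ln 2 + 1.
have K00 : 0 < K0.
  by rewrite ltr_pwDr// divr_ge0 ?(ltW l2)// !addr_ge0 ?(ltW l2) ?mulr_ge0.
exists (N.+1%:R * K0); split; first by rewrite mulr_gt0.
move=> Omega phi H A t M AC tM.
have eng : engulfs theta Omega phi by exact: heng.
have [D [x [Dini DA xsep tdec cover]]] :=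
  greedy_selection (fun y => msection Omega phi y (t y)) tM.
have Cx k : D k -> closure Omega (x k) by move=> Dk; exact: AC (DA _ Dk).
have t0 k : D k -> 0 < t (x k) by move=> Dk; have /andP[] := tM _ (DA _ Dk).
exists D, x; split=> //; split.
- move=> y Ay; apply: contrapT => ny.
  have {}ny k : D k -> ~ msection Omega phi (x k) (t (x k)) y.
    by move=> Dk ky; apply: ny; exists k.
  have h := cover y Ay ny; have /andP[ty0 _] := tM _ Ay.
  apply: (@heights_not_bounded_away _ _ _ _ hn hrho th1 _ _ _ _ H eng D x (t \o x) Cx t0 Dini xsep tdec (t y / 2)).
    by rewrite divr_gt0.
  by move=> k; have [Dk hk] := h k; split=> //=; lra.
- by move=> k Dk [j /= jk]; exact: xsep.
- exact: (selected_disjoint hn th1 H eng (t := t \o x)).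
move=> eps z e01; have /andP[e0 e1] := e01.
apply: esum_indic_le => J uJ hJ.
set mx := Num.max _ _.
have mx1 : 1 <= mx by rewrite le_max lexx.
have mxl : ln eps^-1 <= mx by rewrite le_max lexx orbT.
case: J uJ hJ => [|j0 J0] uJ hJ.
  by rewrite !mulr_ge0// ltW//; lra.
set J := j0 :: J0 in uJ hJ *.
(* The earliest section i dominates: 2 t_i is an upper bound for all heights,
   and none is below 2 t_i / a. *)
have [i iJ imin] : exists2 i, i \in J & forall j, j \in J -> (i <= j)%N.
  have ex : exists i, i \in J by exists j0; rewrite mem_head.
  by exists (ex_minn ex); case: ex_minnP.
have [Di /msectionE[Cz iz]] := hJ i iJ.
have ti := t0 _ Di.
pose d := eps / (Ac + 1).
have d0 : 0 < d by rewrite divr_gt0//; lra.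
have d1 : d <= 1 by rewrite ler_pdivrMr; lra.
have dp0 : 0 < d ^+ p by rewrite exprn_gt0.
have dp1 : d ^+ p <= 1 by rewrite exprn_ile1// ltW.
pose a := 2 * theta / d ^+ p.
have a2 : 2 <= a by rewrite ler_pdivlMr//; nra.
have jlow j : j \in J -> 2 * t (x i) / a <= t (x j) <= 2 * t (x i).
  move=> jJ; have [Dj /msectionE[_ jz]] := hJ j jJ; have tj := t0 _ Dj.
  apply/andP; split; last exact: tdec (imin _ jJ) Dj.
  have -> : 2 * t (x i) / a = d ^+ p * t (x i) / theta.
    by rewrite /a; field; rewrite !gt_eqF.
  rewrite ler_pdivrMr// mulrC [t (x j) * _]mulrC.
  have := imin _ jJ; rewrite leq_eqVlt => /predU1P[ij|ij].
    by rewrite -ij mulrC ler_pM2r//; lra.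
  have jz' : excess Omega phi (x j) z < (t \o x) j.
    by apply: lt_le_trans jz _; apply: ler_piMl; [exact: ltW|lra].
  rewrite mulrC.
  exact: (later_height_lower hn hrho th1 p2 kp H eng Cx t0 Dini xsep ij Dj e01 Cz iz jz').
have cnt := dyadic_count (N := N) (J := J) (t := t \o x) ti a2 jlow.
apply: le_trans (cnt _) _.
  move=> ta J' ta0 sJ hJ'.
  apply: (@generation_count _ _ _ _ hn hrho th1 _ _ _ _ H eng D x (t \o x) Cx t0 Dini xsep tdec N hN z ta) => //.
    exact: subseq_uniq sJ uJ.
  move=> j jJ'; have jJ := mem_subseq sJ jJ'; have [Dj /msectionE[_ jz]] := hJ j jJ.
  split=> //=; last exact: hJ'.
  by apply/ltW/(lt_le_trans jz); apply: ler_piMl; [exact/ltW/t0|lra].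
have lnaE : ln a = ln 2 + ln theta + p%:R * (ln (Ac + 1) + ln eps^-1).
  have -> : a = 2 * theta * (((Ac + 1) * eps^-1) ^+ p).
    rewrite /a /d -exprVn invf_div//.
  have Ac1 : 0 < Ac + 1 by lra.
  have ei : 0 < eps^-1 by rewrite invr_gt0.
  rewrite !lnM ?posrE ?mulr_gt0 ?exprn_gt0// ?mulr_gt0//.
  by rewrite lnXn ?mulr_gt0// lnM ?posrE// mulr_natl.
have step : ln a / ln 2 + 1 <= K0 * mx.
  rewrite /K0 mulrDl mul1r; apply: lerD => //.
  rewrite mulrAC ler_pM2r ?invr_gt0// lnaE.
  have pp : 0 <= p%:R :> R by rewrite ler0n.
  have h1 := ler_wpM2l pp mxl.
  have h2 : 0 <= ln 2 + ln theta + p%:R * ln (Ac + 1) by rewrite !addr_ge0 ?(ltW l2) ?mulr_ge0.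
  have h3 := ler_peMr h2 mx1.
  lra.
apply: (@le_trans _ _ (N%:R * (K0 * mx))); first by rewrite ler_wpM2l.
rewrite mulrA ler_wpM2r ?(le_trans ler01)// ler_wpM2r ?(ltW K00)// ler_nat//.
Qed.
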